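(* Let $\mathcal P_{\mathrm{Av}(231)}$ be the set of $231$-avoiding permutons, with the topology of weak convergence, and let $\mathcal E$ be the set of $1$-Lipschitz functions $\varphi:[0,1]\to[0,\infty)$ with $\varphi(0)=\varphi(1)=0$, with the topology of uniform convergence. The map $\mu\mapsto\varphi_\mu$ sending a $231$-avoiding permuton to its RLM-excursion is a one-to-one correspondence between $\mathcal P_{\mathrm{Av}(231)}$ and $\mathcal E$, and it is bicontinuous (it and its inverse are continuous).
   Context: A permuton is a Borel probability measure $\mu$ on $[0,1]^2$ whose two marginals are the Lebesgue measure on $[0,1]$. A permuton $\mu$ is $231$-avoiding if its density of the pattern $231$ is zero, i.e. $\mu^{\otimes 3}\big(\{((x_1,y_1),(x_2,y_2),(x_3,y_3)) : x_1<x_2<x_3,\ y_3<y_1<y_2\}\big)=0$. The RLM-curve (right-to-left-minima curve) of a permuton $\mu$ is $f_\mu(x):=\max\{y\in[0,1]:\mu([x,1]\times[0,y])=0\}$ for $x\in[0,1]$. It is a càdlàg nondecreasing function $[0,1]\to[0,1]$ with $f_\mu(x)\le x$ and $f_\mu(1)=1$. For a càdlàg nondecreasing $f:[0,1]\to[0,1]$ with $f(x)\le x$ for all $x$ and $f(1)=1$, its completed graph is $G_f=\{(x,y)\in[0,1]^2: f(x^-)\le y\le f(x)\}$ (with the convention $f(0^-)=0$). The excursion associated with $f$ is the function $\varphi\in\mathcal E$ obtained by rotating $G_f$ by $-\pi/4$, flipping, and scaling down by $\sqrt2$; that is, $\varphi$ is the unique function on $[0,1]$ with $G_f=\{(t+\varphi(t),\,t-\varphi(t)):t\in[0,1]\}$.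 The RLM-excursion $\varphi_\mu$ of $\mu$ is the excursion associated with $f_\mu$. *)

(* Defs.v *)
From HB Require Import structures.
From mathcomp Require Import all_boot all_order all_algebra.
From mathcomp Require Import all_classical all_reals all_analysis.
Set Implicit Arguments.
Unset Strict Implicit.
Unset Printing Implicit Defensive.
Import Order.TTheory GRing.Theory Num.Theory.
Import numFieldNormedType.Exports.
Local Open Scope classical_set_scope.
Local Open Scope ring_scope.

Definition unit_interval (R : realType) : set R := `[0, 1].

Definition unit_square (R : realType) : set (R * R) :=
  @unit_interval R `*` @unit_interval R.

(* A Borel probability measure on [0,1]^2 is encoded as a Borel probability
   measure on R^2; the marginals force its mass to sit on [0,1]^2.  Measures are
   total set functions, so [permuton_junk] fixes the irrelevant values on
   non-measurable sets: Leibniz equality is then equality of Borel measures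
   (see [permuton_eq]). *)
Record permuton (R : realType) := Permuton {
  permuton_prob :> probability (R * R)%type R ;
  permuton_marg1 : forall A : set R, measurable A ->
    permuton_prob (A `*` setT) = lebesgue_measure (A `&` @unit_interval R) ;
  permuton_marg2 : forall A : set R, measurable A ->
    permuton_prob (setT `*` A) = lebesgue_measure (A `&` @unit_interval R) ;
  permuton_junk : forall A : set (R * R), ~ measurable A ->
    permuton_prob A = 0%E }.

HB.instance Definition _ (R : realType) := gen_eqMixin (permuton R).
HB.instance Definition _ (R : realType) := gen_choiceMixin (permuton R).

Definition test_function (R : realType) : Type :=
  [set g : R * R -> R | {within @unit_square R, continuous g}].

Definition permuton_pairing (R : realType) (mu : permuton R) :
    {ptws test_function R -> R} :=
  fun g => \int[mu]_(x in @unit_square R) (val g) x.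

(* Topology of weak convergence: the coarsest one making mu |-> \int g dmu
   continuous for every g continuous on [0,1]^2. *)
HB.instance Definition _ (R : realType) :=
  Topological.copy (permuton R) (initial_topology (@permuton_pairing R)).

Definition occ231 (R : realType) : set ((R * R) * (R * R) * (R * R)) :=
  [set p | let: ((x1, y1), (x2, y2), (x3, y3)) := p in
    [/\ x1 < x2, x2 < x3, y3 < y1 & y1 < y2] ].

Definition Av231 (R : realType) : set (permuton R) :=
  [set mu | ((mu \x mu) \x mu)%E (@occ231 R) = 0%E].

Definition rlm_set (R : realType) (mu : permuton R) (x : R) : set R :=
  [set y | 0 <= y <= 1 /\ mu (`[x, 1] `*` `[0, y]) = 0%E].

(* The maximum of [rlm_set mu x], which exists for x in [0,1]
   (see [rlm_curve_max]). *)
Definition rlm_curve (R : realType) (mu : permuton R) (x : R) : R :=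
  xget 0 (rlm_set mu x `&` ubound (rlm_set mu x)).

Definition left_value (R : realType) (f : R -> R) (x : R) : R :=
  if x == 0 then 0 else lim (f y @[y --> x^'-]).

Definition completed_graph (R : realType) (f : R -> R) : set (R * R) :=
  [set p | unit_square p /\ left_value f p.1 <= p.2 <= f p.1].

(* [phi] is the excursion associated with [f]; there is at most one
   (see [is_excursion_uniq]). *)
Definition is_excursion (R : realType) (f : R -> R)
    (phi : @unit_interval R -> R) : Prop :=
  completed_graph f =
    range (fun t : @unit_interval R => (val t + phi t, val t - phi t)).

Definition excursions (R : realType) : set {uniform @unit_interval R -> R} :=
  [set phi | [/\ forall s t : @unit_interval R,
                   `|phi s - phi t| <= `|val s - val t|,
                 forall t : @unit_interval R, 0 <= phi t &
                 forall t : @unit_interval R,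
                   val t = 0 \/ val t = 1 -> phi t = 0] ].

Lemma permuton_eq (R : realType) (mu nu : permuton R) :
  (forall A : set (R * R), measurable A -> mu A = nu A) -> mu = nu.
Proof.
move=> mn.
have {mn} : (mu : set (R * R) -> \bar R) = nu.
  apply/funext => A; have [/mn//|nA] := pselect (measurable A).
  by rewrite !permuton_junk.
case: mu nu => [m m1 m2 mj] [n n1 n2 nj] /= mn.
suff e : m = n.
  by subst n; congr Permuton; exact: Prop_irrelevance.
case: m n mn {m1 m2 mj n1 n2 nj} => [m cm] [n cn] /= mn; subst n.
congr Probability.Pack.
case: cm cn => [[a1 a2] [a3] [a4] [a5] [a6] [a7] [a8]].
move=> [[b1 b2] [b3] [b4] [b5] [b6] [b7] [b8]].
have e1 := Prop_irrelevance b1 a1; have e2 := Prop_irrelevance b2 a2.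
by subst b1 b2; congr Probability.Class; congr (_ _); exact: Prop_irrelevance.
Qed.

Lemma is_excursion_uniq (R : realType) (f : R -> R)
    (phi psi : @unit_interval R -> R) :
  is_excursion f phi -> is_excursion f psi -> phi = psi.
Proof.
rewrite /is_excursion => -> e; apply/funext => t.
have : range (fun s : @unit_interval R => (val s + phi s, val s - phi s))
    (val t + phi t, val t - phi t) by exists t.
rewrite e => -[s _ [e1 e2]].
have st : s = t.
  apply: val_inj => /=.
  have : val s *+ 2 = val t *+ 2.
    transitivity ((val s + psi s) + (val s - psi s)).
      by rewrite addrACA subrr addr0 mulr2n.
    by rewrite e1 e2 addrACA subrr addr0 mulr2n.
  by move/eqP; rewrite eqrMn2r // => /eqP.
by move: e1; rewrite st => /addrI.
Qed.

Lemma rlm_curve_max (R : realType) (mu : permuton R) (x : R) :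
  rlm_set mu x (rlm_curve mu x) /\
  forall y, rlm_set mu x y -> y <= rlm_curve mu x.
Proof.
pose A := rlm_set mu x.
have mX (y : R) : measurable (`[x, 1] `*` `[0, y] : set (R * R)).
  by apply: measurableX; exact: measurable_itv.
have A0 : A 0.
  split; first by rewrite lexx ler01.
  apply/eqP; rewrite -measure_le0.
  apply: (@le_trans _ _ (mu (setT `*` [set 0]))).
    apply: le_measure; rewrite ?inE //.
      by apply: measurableX => //; exact: measurable_set1.
    by move=> [u v] [_] /=; rewrite in_itv /= => /le_anti <-.
  rewrite permuton_marg2 //.
  apply: (@le_trans _ _ (lebesgue_measure [set (0 : R)])).
    apply: le_measure; rewrite ?inE //.
    by apply: measurableI => //; exact: measurable_itv.
  by rewrite lebesgue_measure_set1.
have hA : has_sup A.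
  by split; [exists 0|exists 1 => y [/andP[]]].
have As : A (sup A).
  have s0 : 0 <= sup A by exact: (ub_le_sup hA.2 A0).
  have s1 : sup A <= 1 by apply: ge_sup; [exists 0|move=> y [/andP[]]].
  split; first by rewrite s0 s1.
  apply/eqP; rewrite -measure_le0; apply/lee_addgt0Pr => e e0.
  have [y Ay ye] := sup_adherent e0 hA.
  rewrite add0e.
  have ys : y <= sup A by exact: (ub_le_sup hA.2 Ay).
  have sub : `[x, 1] `*` `[0, sup A] `<=`
      (`[x, 1] `*` `[0, y]) `|` (setT `*` `]y, sup A] : set (R * R)).
    move=> [u v] [ux] /=; rewrite in_itv /= => /andP[v0 vs].
    have [vy|yv] := leP v y; first by left; split => //=; rewrite in_itv /= v0.
    by right; split => //=; rewrite in_itv /= yv.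
  have mY : measurable (setT `*` `]y, sup A] : set (R * R)).
    by apply: measurableX => //; exact: measurable_itv.
  apply: (@le_trans _ _ (mu ((`[x, 1] `*` `[0, y]) `|` (setT `*` `]y, sup A])))).
    by apply: le_measure; rewrite ?inE //; exact: measurableU.
  apply: le_trans (measureU2 _ _ _) _ => //.
  rewrite -[leRHS]add0e; apply: leeD.
    by rewrite le_eqVlt; apply/orP; left; apply/eqP; exact: Ay.2.
  rewrite [leLHS](permuton_marg2 mu); last exact: measurable_itv.
  apply: (@le_trans _ _ (lebesgue_measure (`]y, sup A] : set R))).
    apply: le_measure; rewrite ?inE //.
    by apply: measurableI; exact: measurable_itv.
  rewrite lebesgue_measure_itv /= lte_fin; case: ifP => // _; last exact: ltW.
  by rewrite EFinN -EFinB lee_fin lerBlDr -lerBlDl ltW.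
have M : (A `&` ubound A) (sup A) by split=> // y Ay; exact: (ub_le_sup hA.2 Ay).
rewrite /rlm_curve -/A.
by have [Ax Ux] : (A `&` ubound A) (xget 0 (A `&` ubound A)) by exact: xgetI M.
Qed.

(* Main.v *)
Require Import Defs.
From HB Require Import structures.
From mathcomp Require Import all_boot all_order all_algebra.
From mathcomp Require Import all_classical all_reals all_analysis.
From mathcomp Require Import lra.
Set Implicit Arguments.
Unset Strict Implicit.
Unset Printing Implicit Defensive.
Import Order.TTheory GRing.Theory Num.Theory.
Import numFieldNormedType.Exports.
Local Open Scope classical_set_scope.
Local Open Scope ring_scope.

(** The 231-avoiding permutations are those produced by a stack: positions are
pushed in increasing order and values are popped in increasing order. The
excursion is the height of the stack, so it encodes the path of pushes and pops
t -> (X_t, Y_t) = (t + phi t, t - phi t), which is the completed RLM-curve. The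
proof works with the distribution function F(x, y) = mu([0, x] * [0, y]). For a
stack, F(x, y) is the amount pushed before x and popped before y, namely
<<
  C_phi(x, y) = sup over t of min(Y_t, y) - max(X_t - x, 0)
>>
([stack_cdf]).

Every permuton satisfies F >= C_phi for its own excursion: if (X, Y) is below
the RLM-curve, all the heights up to Y are used left of X
([stack_cdf_le_joint_cdf]). If equality failed at (x, y), positive masses would
form the pattern 231; so F = C_phi for 231-avoiding permutons
([joint_cdf_le_stack_cdf]), and the excursion determines the permuton, because F
does ([permuton_cdf_eq]).

Conversely, C_phi has uniform margins and is supermodular, because the path is
monotone ([stack_cdf_supermod]): it is a copula. A copula is the distribution
function of a permuton ([copula_permuton]): halve the unit square repeatedly,
assign to the cells nested intervals of [0, 1[ of length their prescribed
mass, and transport the Lebesgue measure by the map sending a number to the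
point where its cells shrink. For C_phi, the permuton avoids 231
([stack_cdf_Av231]).

Finally phi -> C_phi is bi-Lipschitz in the uniform norms ([stack_cdf_dist] and
[excursion_dist]). This shows at once that the excursion of the permuton built
from phi is phi, and reduces bicontinuity to the equivalence, for permutons, of
weak convergence and uniform convergence of distribution functions
([cdf_close_near] and [permuton_pairing_close]). *)

(** * Excursions and their distribution functions *)

Section StackCdf.
Context (R : realType).
Local Notation I := (@unit_interval R).
Implicit Types (phi psi : I -> R) (x y : R).

Lemma unit_val (r : I) : 0 <= val r <= 1.
Proof. by have := set_valP r; rewrite /unit_interval /= in_itv. Qed.

Lemma unit_pt (t : R) : 0 <= t <= 1 -> exists r : I, val r = t.
Proof.
move=> t01; have h : I t by rewrite /unit_interval /= in_itv.
by exists (SigSub (mem_set h)).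
Qed.

(** In the stack reading of an excursion, [path_x phi r] and [path_y phi r] are
the amounts pushed and popped by time [r]; the height of the stack is twice
[phi r]. *)
Definition path_x phi (r : I) : R := val r + phi r.
Definition path_y phi (r : I) : R := val r - phi r.

(** In a permuton whose RLM-curve passes through (X, Y), the whole mass of the
strip of heights below Y lies left of X; moving X back to x loses at most
X - x, so this quantity bounds from below the mass of [0, x] * [0, y]. *)
Definition path_bound phi x y (r : I) : R :=
  Num.min (path_y phi r) y - Num.max (path_x phi r - x) 0.

(** A path bound is the minimum of four linear expressions. This lemma and
[path_bound_attained] state it in a form that linear arithmetic can use. *)
Lemma path_bound_ub phi x y r :
  [/\ path_bound phi x y r <= path_y phi r, path_bound phi x y r <= y,
      path_bound phi x y r <= path_y phi r - (path_x phi r - x) &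
      path_bound phi x y r <= y - (path_x phi r - x)].
Proof.
rewrite /path_bound.
by case: (leP (path_y phi r) y); case: (leP (path_x phi r - x) 0) => ? ?;
  split; lra.
Qed.

Lemma path_bound_attained phi x y r :
  [\/ path_bound phi x y r = path_y phi r, path_bound phi x y r = y,
      path_bound phi x y r = path_y phi r - (path_x phi r - x) |
      path_bound phi x y r = y - (path_x phi r - x)].
Proof.
rewrite /path_bound.
case: (leP (path_y phi r) y); case: (leP (path_x phi r - x) 0) => _ _.
- by apply: Or41; lra.
- by apply: Or43; lra.
- by apply: Or42; lra.
- by apply: Or44; lra.
Qed.

(** The mass pushed before the path reaches abscissa x and popped before it
reaches ordinate y. If the path reaches abscissa x at time s, before it reaches
ordinate y at time t, this is x minus twice the minimum of [phi] on [s, t];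
otherwise it is y. The supremum covers both cases and does not mention s and t,
which depend badly on [phi] where the path is horizontal or vertical. *)
Definition stack_cdf phi x y : R := sup (range (path_bound phi x y)).

Lemma path_bound_le_stack_cdf phi x y r : path_bound phi x y r <= stack_cdf phi x y.
Proof.
apply: ub_le_sup; last by exists r.
by exists y => _ [q _ <-]; have [] := path_bound_ub phi x y q.
Qed.

Lemma stack_cdf_ge phi x y r c :
  c <= path_y phi r -> c <= y -> c <= path_y phi r - (path_x phi r - x) ->
  c <= y - (path_x phi r - x) -> c <= stack_cdf phi x y.
Proof.
move=> ? ? ? ?; have := path_bound_le_stack_cdf phi x y r.
by case: (path_bound_attained phi x y r) => ->; lra.
Qed.

Lemma stack_cdf_le phi x y c :
  (forall r b, b <= path_y phi r -> b <= y ->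
     b <= path_y phi r - (path_x phi r - x) ->
     b <= y - (path_x phi r - x) -> b <= c) ->
  stack_cdf phi x y <= c.
Proof.
move=> h; apply: ge_sup => [|_ [q _ <-] //].
  have [|r _] := @unit_pt 0; first by lra.
  by exists (path_bound phi x y r); exists r.
by have [] := path_bound_ub phi x y q; exact: h.
Qed.

Lemma stack_cdf_adherent phi x y c :
  c < stack_cdf phi x y -> exists r, c < path_bound phi x y r.
Proof.
move=> h; have [|_ [r _ <-] rc] := @sup_gt _ (range (path_bound phi x y)) c _ h.
  have [|r _] := @unit_pt 0; first by lra.
  by exists (path_bound phi x y r); exists r.
by exists r.
Qed.

Lemma stack_cdf_dist phi psi e x y :
  (forall r, `|phi r - psi r| <= e) ->
  `|stack_cdf phi x y - stack_cdf psi x y| <= e *+ 2.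
Proof.
have h phi' psi' : (forall r, `|phi' r - psi' r| <= e) ->
    stack_cdf phi' x y <= stack_cdf psi' x y + e *+ 2.
  move=> d; apply: stack_cdf_le => r b; have := d r; rewrite ler_norml.
  rewrite /path_x /path_y => /andP[? ?] ? ? ? ?.
  rewrite -lerBlDr; apply: (@stack_cdf_ge _ _ _ r); rewrite /path_x /path_y; lra.
move=> d; have := h _ _ d.
have /h : (forall r, `|psi r - phi r| <= e) by move=> r; rewrite distrC.
by rewrite ler_norml; lra.
Qed.

(** Membership in [excursions], for plain functions rather than points of a space
of functions with its uniform structure. *)
Definition excursion_function phi :=
  [/\ forall s t : I, `|phi s - phi t| <= `|val s - val t|,
      forall t : I, 0 <= phi t &
      forall t : I, val t = 0 \/ val t = 1 -> phi t = 0].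

Section Excursion.
Variable phi : I -> R.
Hypothesis ephi : excursion_function phi.

Lemma path_xy_mono (r q : I) : val r <= val q ->
  path_x phi r <= path_x phi q /\ path_y phi r <= path_y phi q.
Proof.
case: ephi => lip _ _ rq; have := lip r q.
rewrite (ler0_norm (_ : val r - val q <= 0)); last by lra.
by rewrite ler_norml /path_x /path_y; lra.
Qed.

Lemma path_y_le_x r : path_y phi r <= path_x phi r.
Proof. by case: ephi => _ p0 _; have := p0 r; rewrite /path_x /path_y; lra. Qed.

Lemma path_start : exists r, path_x phi r = 0 /\ path_y phi r = 0.
Proof.
have [|r rE] := @unit_pt 0; first by lra.
exists r; case: ephi => _ _ p1.
by rewrite /path_x /path_y p1 ?rE; [lra|left].
Qed.

Lemma path_end : exists r, path_x phi r = 1 /\ path_y phi r = 1.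
Proof.
have [|r rE] := @unit_pt 1; first by lra.
exists r; case: ephi => _ _ p1.
by rewrite /path_x /path_y p1 ?rE; [lra|right].
Qed.

Lemma path_xy_01 r : 0 <= path_y phi r /\ path_x phi r <= 1.
Proof.
have [|r0 r0E] := @unit_pt 0; first by lra.
have [|r1 r1E] := @unit_pt 1; first by lra.
have /andP[r_ge0 r_le1] := unit_val r.
have := @path_xy_mono r0 r; have := @path_xy_mono r r1.
case: ephi => _ _ p; rewrite /path_x /path_y r0E r1E (p r0) ?(p r1); [|by right|by left].
by move=> /(_ r_le1) + /(_ r_ge0); lra.
Qed.

Lemma stack_cdf_top x : 0 <= x <= 1 -> stack_cdf phi x 1 = x.
Proof.
move=> x01; apply: le_anti; apply/andP; split.
  by apply: stack_cdf_le => r b; have := path_y_le_x r; lra.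
by have [r [xr yr]] := path_end; apply: (@stack_cdf_ge _ _ _ r); lra.
Qed.

Lemma stack_cdf_right y : 0 <= y <= 1 -> stack_cdf phi 1 y = y.
Proof.
move=> y01; apply: le_anti; apply/andP; split.
  by apply: stack_cdf_le => r b; lra.
by have [r [xr yr]] := path_end; apply: (@stack_cdf_ge _ _ _ r); lra.
Qed.

Lemma stack_cdf_left y : 0 <= y <= 1 -> stack_cdf phi 0 y = 0.
Proof.
move=> y01; apply: le_anti; apply/andP; split.
  by apply: stack_cdf_le => r b; have := path_y_le_x r; lra.
by have [r [xr yr]] := path_start; apply: (@stack_cdf_ge _ _ _ r); lra.
Qed.

Lemma stack_cdf_bottom x : 0 <= x <= 1 -> stack_cdf phi x 0 = 0.
Proof.
move=> x01; apply: le_anti; apply/andP; split.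
  by apply: stack_cdf_le => r b; lra.
by have [r [xr yr]] := path_start; apply: (@stack_cdf_ge _ _ _ r); lra.
Qed.

(** The path bounds at two times r <= q are supermodular, because r -> (X, Y) is
nondecreasing and both min(Y, y) and - max(X - x, 0) have increasing
differences. Assigning the earlier time to (x, y) and the later one to (x', y')
therefore never lowers the sum. *)
Lemma stack_cdf_supermod x x' y y' : x <= x' -> y <= y' ->
  stack_cdf phi x y' + stack_cdf phi x' y <=
  stack_cdf phi x y + stack_cdf phi x' y'.
Proof.
move=> xx' yy'; apply/ler_addgt0Pr => e e0.
have [|r rP] := @stack_cdf_adherent phi x y' (stack_cdf phi x y' - e / 2).
  by lra.
have [|q qP] := @stack_cdf_adherent phi x' y (stack_cdf phi x' y - e / 2).
  by lra.
have [r1 r2 r3 r4] := path_bound_ub phi x y' r.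
have [q1 q2 q3 q4] := path_bound_ub phi x' y q.
have [/path_xy_mono[mx my]|/ltW /path_xy_mono[mx my]] := leP (val r) (val q).
  have := path_bound_le_stack_cdf phi x y r.
  have := path_bound_le_stack_cdf phi x' y' q.
  by case: (path_bound_attained phi x y r) => ->;
    case: (path_bound_attained phi x' y' q) => ->; lra.
have := path_bound_le_stack_cdf phi x y q.
have := path_bound_le_stack_cdf phi x' y' r.
by case: (path_bound_attained phi x y q) => ->;
  case: (path_bound_attained phi x' y' r) => ->; lra.
Qed.

(** The point (t + h, t - h) lies on the antidiagonal through the path point of
time t. Times before t contribute at most Y_r <= Y_t, and times after t at most
y + x - X_r <= 2 t - X_t = Y_t. *)
Lemma stack_cdf_antidiag (t : I) (h : R) :
  stack_cdf phi (val t + h) (val t - h) <= path_y phi t.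
Proof.
apply: stack_cdf_le => r b.
have [/path_xy_mono[]|/ltW /path_xy_mono[]] := leP (val r) (val t).
  by lra.
by rewrite /path_x /path_y; lra.
Qed.

Lemma stack_cdf_path (t : I) :
  stack_cdf phi (path_x phi t) (path_y phi t) = path_y phi t.
Proof.
apply: le_anti; apply/andP; split.
  by apply: stack_cdf_le => r b; lra.
by apply: (@stack_cdf_ge _ _ _ t); lra.
Qed.

(** The three increments are the masses of the three zones that a pattern 231
separated by the lines x = a, x = b, y = c, y = d would need. If the first two
are positive, a nearly optimal time r for (a, d) has X_r <= b and hence Y_r < c,
so that it is as good for (a, c). *)
Lemma stack_cdf_av231 a b c d : a <= b -> c <= d ->
  [\/ stack_cdf phi b c = c,
      stack_cdf phi b d - stack_cdf phi a d = b - a |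
      stack_cdf phi a d = stack_cdf phi a c].
Proof.
move=> ab cd.
have Cc : stack_cdf phi b c <= c by apply: stack_cdf_le => r s; lra.
have Cd : stack_cdf phi b d - stack_cdf phi a d <= b - a.
  rewrite lerBlDr; apply: stack_cdf_le => r s ? ? ? ?.
  suff : s - (b - a) <= stack_cdf phi a d by lra.
  by apply: (@stack_cdf_ge _ _ _ r); lra.
have Ca : stack_cdf phi a c <= stack_cdf phi a d.
  by apply: stack_cdf_le => r s ? ? ? ?; apply: (@stack_cdf_ge _ _ _ r); lra.
have [c1|c1] := ltP (stack_cdf phi b c) c; last by apply: Or31; lra.
have [d1|d1] := ltP (stack_cdf phi b d - stack_cdf phi a d) (b - a); last first.
  by apply: Or32; lra.
apply: Or33; apply: le_anti; apply/andP; split => //.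
rewrite leNgt; apply/negP => lt_ac.
pose m := Num.max (stack_cdf phi a c) (stack_cdf phi b d - (b - a)).
have [ma mb] : stack_cdf phi a c <= m /\ stack_cdf phi b d - (b - a) <= m.
  by rewrite /m; split; rewrite le_max lexx ?orbT.
have [|r rP] := @stack_cdf_adherent phi a d m; first by rewrite gt_max; lra.
have [r1 r2 r3 r4] := path_bound_ub phi a d r.
have [rb|rb] := leP (path_x phi r) b; last first.
  suff : path_bound phi a d r + (b - a) <= stack_cdf phi b d by lra.
  by apply: (@stack_cdf_ge _ _ _ r); lra.
have [rc|rc] := leP c (path_y phi r).
  suff : c <= stack_cdf phi b c by lra.
  by apply: (@stack_cdf_ge _ _ _ r); lra.
suff : path_bound phi a d r <= stack_cdf phi a c by lra.
by apply: (@stack_cdf_ge _ _ _ r); lra.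
Qed.

End Excursion.

(** Evaluated at the path point of [psi] at time t, the distribution function of
[psi] is t - psi t, while by [stack_cdf_antidiag] that of [phi] is at most
t - phi t. Together with [stack_cdf_dist], this makes excursions and their
distribution functions uniformly equivalent, and in particular [stack_cdf]
injective. *)
Lemma excursion_dist phi psi (e : R) :
  excursion_function phi -> excursion_function psi ->
  (forall x y, 0 <= x <= 1 -> 0 <= y <= 1 ->
     `|stack_cdf phi x y - stack_cdf psi x y| <= e) ->
  forall t, `|phi t - psi t| <= e.
Proof.
have h (f g : I -> R) : excursion_function f -> excursion_function g ->
    (forall x y, 0 <= x <= 1 -> 0 <= y <= 1 ->
      `|stack_cdf f x y - stack_cdf g x y| <= e) ->
    forall t, f t - g t <= e.
  move=> ef eg d t.
  have px := path_xy_01 eg t; have py := path_y_le_x eg t.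
  have := stack_cdf_antidiag ef t (g t); have := stack_cdf_path g t.
  have /ler_normlP[] : `|stack_cdf f (path_x g t) (path_y g t) -
      stack_cdf g (path_x g t) (path_y g t)| <= e by apply: d; lra.
  by rewrite /path_x /path_y; lra.
move=> ephi epsi d t; rewrite ler_norml.
have := h _ _ ephi epsi d t.
have : psi t - phi t <= e.
  by apply: h => // x y x01 y01; rewrite distrC; exact: d.
by lra.
Qed.

End StackCdf.

(** * Distribution functions of permutons *)

Section Mass.
Context (R : realType).
Implicit Types (mu nu : permuton R) (x y : R) (A B : set R).

(** Permutons are finite measures: real values make linear arithmetic available. *)
Definition mass mu (S : set (R * R)) : R := fine (mu S).

Lemma massE mu S : measurable S -> mu S = (mass mu S)%:E.
Proof. by move=> mS; rewrite /mass fineK // fin_num_measure. Qed.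

Lemma mass_ge0 mu S : 0 <= mass mu S.
Proof. exact: fine_ge0. Qed.

Lemma le_mass mu S T : measurable S -> measurable T -> S `<=` T ->
  mass mu S <= mass mu T.
Proof.
by move=> mS mT ST; rewrite -lee_fin -!massE //; apply: le_measure; rewrite ?inE.
Qed.

Lemma massU mu S T : measurable S -> measurable T -> S `&` T = set0 ->
  mass mu (S `|` T) = mass mu S + mass mu T.
Proof.
move=> mS mT ST; apply: EFin_inj.
by rewrite EFinD -!massE ?measureU //; exact: measurableU.
Qed.

Lemma mass_subadd mu S T : measurable S -> measurable T ->
  mass mu (S `|` T) <= mass mu S + mass mu T.
Proof.
move=> mS mT; rewrite -lee_fin EFinD -!massE //; last exact: measurableU.
exact: measureU2.
Qed.

Lemma mass_split mu S T V : measurable S -> measurable T ->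
  (forall p, V p <-> S p \/ T p) -> (forall p, S p -> ~ T p) ->
  mass mu V = mass mu S + mass mu T.
Proof.
move=> mS mT VST ST; rewrite -massU //.
  by congr (mass mu _); apply/seteqP; split=> p /VST.
by apply/seteqP; split => // p [Sp /(ST p Sp)].
Qed.

Lemma mass_setX1 mu A : measurable A ->
  (mass mu (A `*` setT))%:E = lebesgue_measure (A `&` @unit_interval R).
Proof. by move=> mA; rewrite -massE ?permuton_marg1 //; exact: measurableX. Qed.

Lemma mass_setX2 mu A : measurable A ->
  (mass mu (setT `*` A))%:E = lebesgue_measure (A `&` @unit_interval R).
Proof. by move=> mA; rewrite -massE ?permuton_marg2 //; exact: measurableX. Qed.

Definition joint_cdf mu x y : R := mass mu (`]-oo, x] `*` `]-oo, y]).

Lemma measurable_quadrant x y : measurable (`]-oo, x] `*` `]-oo, y] : set (R * R)).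
Proof. by apply: measurableX; exact: measurable_itv. Qed.

Lemma mass_strip1 mu a b B : a <= b -> measurable B ->
  mass mu (`]a, b] `*` B) = mass mu (`]-oo, b] `*` B) - mass mu (`]-oo, a] `*` B).
Proof.
move=> ab mB; apply/eqP; rewrite eq_sym subr_eq; apply/eqP.
apply: mass_split; [exact: measurableX|exact: measurableX| |] => -[u v] /=;
  rewrite !in_itv /=; last by move=> [/andP[]]; lra.
split; last by move=> [[/andP[]]|[]]; split => //; lra.
by move=> [ub Bv]; have [ua|ua] := leP u a; [right|left; rewrite ub].
Qed.

Lemma mass_strip2 mu c d A : c <= d -> measurable A ->
  mass mu (A `*` `]c, d]) = mass mu (A `*` `]-oo, d]) - mass mu (A `*` `]-oo, c]).
Proof.
move=> cd mA; apply/eqP; rewrite eq_sym subr_eq; apply/eqP.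
apply: mass_split; [exact: measurableX|exact: measurableX| |] => -[u v] /=;
  rewrite !in_itv /=; last by move=> [_ /andP[]]; lra.
split; last by move=> [[? /andP[]]|[]]; split => //; lra.
by move=> [Au vd]; have [vc|vc] := leP v c; [right|left; rewrite vd].
Qed.

Lemma mass_rect mu a b c d : a <= b -> c <= d ->
  mass mu (`]a, b] `*` `]c, d]) =
  joint_cdf mu b d - joint_cdf mu a d - (joint_cdf mu b c - joint_cdf mu a c).
Proof. by move=> ab cd; rewrite mass_strip2 ?mass_strip1. Qed.

Lemma lebesgue_lower (y : R) : 0 <= y <= 1 ->
  lebesgue_measure (`]-oo, y] `&` @unit_interval R) = y%:E.
Proof.
move=> /andP[y0 y1]; rewrite (_ : _ `&` _ = `[0, y]%classic); last first.
  apply/seteqP; split => u; rewrite /unit_interval /= !in_itv /=.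
    by move=> [uy /andP[u0 u1]]; rewrite u0.
  by move=> /andP[-> uy]; rewrite uy (le_trans uy).
rewrite lebesgue_measure_itv /= lte_fin; case: ltP => [|y0'].
  by rewrite sube0.
by congr EFin; apply: le_anti; rewrite y0.
Qed.

Lemma mass_lower1 mu x : 0 <= x <= 1 -> mass mu (`]-oo, x] `*` setT) = x.
Proof. by move=> x01; apply: EFin_inj; rewrite mass_setX1// lebesgue_lower. Qed.

Lemma mass_lower2 mu y : 0 <= y <= 1 -> mass mu (setT `*` `]-oo, y]) = y.
Proof. by move=> x01; apply: EFin_inj; rewrite mass_setX2// lebesgue_lower. Qed.

Lemma joint_cdf_le1 mu x y : 0 <= x <= 1 -> joint_cdf mu x y <= x.
Proof.
move=> x01; rewrite -[leRHS](mass_lower1 mu x01); apply: le_mass.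
- exact: measurable_quadrant.
- by apply: measurableX => //; exact: measurable_itv.
- by move=> [u v] [].
Qed.

Lemma joint_cdf_le2 mu x y : 0 <= y <= 1 -> joint_cdf mu x y <= y.
Proof.
move=> y01; rewrite -[leRHS](mass_lower2 mu y01); apply: le_mass.
- exact: measurable_quadrant.
- by apply: measurableX => //; exact: measurable_itv.
- by move=> [u v] [].
Qed.

Lemma mass_beyond1 mu B : measurable B -> mass mu (`]1, +oo[ `*` B) = 0.
Proof.
move=> mB; apply: le_anti; rewrite mass_ge0 andbT.
apply: (@le_trans _ _ (mass mu (`]1, +oo[ `*` setT))).
  by apply: le_mass; [exact: measurableX|exact: measurableX|move=> [u v] []].
rewrite -lee_fin mass_setX1 // (_ : _ `&` _ = set0) ?measure0 //.
apply/seteqP; split => // u; rewrite /unit_interval /= !in_itv /= andbT.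
by move=> [? /andP[]]; lra.
Qed.

Lemma mass_beyond2 mu A : measurable A -> mass mu (A `*` `]1, +oo[) = 0.
Proof.
move=> mA; apply: le_anti; rewrite mass_ge0 andbT.
apply: (@le_trans _ _ (mass mu (setT `*` `]1, +oo[))).
  by apply: le_mass; [exact: measurableX|exact: measurableX|move=> [u v] []].
rewrite -lee_fin mass_setX2 // (_ : _ `&` _ = set0) ?measure0 //.
apply/seteqP; split => // u; rewrite /unit_interval /= !in_itv /= andbT.
by move=> [? /andP[]]; lra.
Qed.

Lemma mass_cut1 mu B : measurable B -> mass mu (setT `*` B) = mass mu (`]-oo, 1] `*` B).
Proof.
move=> mB; rewrite -[RHS]addr0 -(mass_beyond1 mu mB).
apply: mass_split; [exact: measurableX|exact: measurableX| |] => -[u v] /=;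
  rewrite !in_itv /= ?andbT; last by move=> []; lra.
split; last by move=> [] [].
by move=> [_ Bv]; have [u1|u1] := leP u 1; [left|right].
Qed.

Lemma mass_cut2 mu A : measurable A -> mass mu (A `*` setT) = mass mu (A `*` `]-oo, 1]).
Proof.
move=> mA; rewrite -[RHS]addr0 -(mass_beyond2 mu mA).
apply: mass_split; [exact: measurableX|exact: measurableX| |] => -[u v] /=;
  rewrite !in_itv /= ?andbT; last by move=> [] ? ? []; lra.
split; last by move=> [] [].
by move=> [Au _]; have [v1|v1] := leP v 1; [left|right].
Qed.

Lemma joint_cdf_top mu x : 0 <= x <= 1 -> joint_cdf mu x 1 = x.
Proof. by move=> x01; rewrite /joint_cdf -mass_cut2 ?mass_lower1. Qed.

Lemma joint_cdf_right mu y : 0 <= y <= 1 -> joint_cdf mu 1 y = y.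
Proof. by move=> y01; rewrite /joint_cdf -mass_cut1 ?mass_lower2. Qed.

(** The uniform marginals make distribution functions 1-Lipschitz in each
variable. *)
Lemma joint_cdf_incr1 mu x x' y : 0 <= x -> x <= x' -> x' <= 1 ->
  joint_cdf mu x y <= joint_cdf mu x' y <= joint_cdf mu x y + (x' - x).
Proof.
move=> x0 xx' x1; apply/andP; split.
  apply: le_mass; [exact: measurable_quadrant|exact: measurable_quadrant|].
  by move=> [u v] [/= ux vy]; split => //=; move: ux; rewrite !in_itv /=; lra.
rewrite -lerBlDl /joint_cdf -mass_strip1 //.
apply: (@le_trans _ _ (mass mu (`]x, x'] `*` setT))).
  by apply: le_mass; [exact: measurableX|exact: measurableX|move=> [u v] []].
by rewrite mass_strip1 // !mass_lower1 //; lra.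
Qed.

Lemma joint_cdf_incr2 mu x y y' : 0 <= y -> y <= y' -> y' <= 1 ->
  joint_cdf mu x y <= joint_cdf mu x y' <= joint_cdf mu x y + (y' - y).
Proof.
move=> y0 yy' y1; apply/andP; split.
  apply: le_mass; [exact: measurable_quadrant|exact: measurable_quadrant|].
  by move=> [u v] [/= ux vy]; split => //=; move: vy; rewrite !in_itv /=; lra.
rewrite -lerBlDl /joint_cdf -mass_strip2 //.
apply: (@le_trans _ _ (mass mu (setT `*` `]y, y']))).
  by apply: le_mass; [exact: measurableX|exact: measurableX|move=> [u v] []].
by rewrite mass_strip2 // !mass_lower2 //; lra.
Qed.

Lemma mass_below2 mu A y : measurable A -> y <= 0 -> mass mu (A `*` `]-oo, y]) = 0.
Proof.
move=> mA y0; apply: le_anti; rewrite mass_ge0 andbT.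
rewrite -(@mass_lower2 mu 0) ?lexx ?ler01 //.
apply: le_mass; [exact: measurableX|exact: measurableX|].
by move=> [u v] [] _ /=; rewrite !in_itv /= => ?; split => //=; lra.
Qed.

Lemma mass_below1 mu B x : measurable B -> x <= 0 -> mass mu (`]-oo, x] `*` B) = 0.
Proof.
move=> mB y0; apply: le_anti; rewrite mass_ge0 andbT.
rewrite -(@mass_lower1 mu 0) ?lexx ?ler01 //.
apply: le_mass; [exact: measurableX|exact: measurableX|].
by move=> [u v] [] /=; rewrite !in_itv /= => ? ?; split => //=; lra.
Qed.

Lemma mass_line1 mu x : mass mu ([set x] `*` setT) = 0.
Proof.
apply: EFin_inj; rewrite mass_setX1 //; apply/eqP; rewrite -measure_le0.
rewrite -(lebesgue_measure_set1 x); apply: le_measure; rewrite ?inE //.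
by apply: measurableI => //; exact: measurable_itv.
Qed.

(** The closed boundary lines have zero mass because the marginals are
diffuse. *)
Lemma rlm_mass mu x y : 0 <= x <= 1 -> 0 <= y <= 1 ->
  mass mu (`[x, 1] `*` `[0, y]) = y - joint_cdf mu x y.
Proof.
move=> x01 y01; rewrite -[X in _ = X - _](joint_cdf_right mu y01) /joint_cdf.
rewrite -mass_strip1 //; last by lra.
pose L := ([set x] `*` setT : set (R * R)); pose S := ((setT `*` `]-oo, 0]) : set (R * R)).
have mL : measurable L by exact: measurableX.
have mS : measurable S by exact: measurableX.
have mo : measurable (`]x, 1] `*` `]-oo, y] : set (R * R)) by exact: measurableX.
have mc : measurable (`[x, 1] `*` `[0, y] : set (R * R)) by exact: measurableX.
apply: le_anti; apply/andP; split.
  apply: (@le_trans _ _ (mass mu ((`]x, 1] `*` `]-oo, y]) `|` L))).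
    apply: le_mass => //; first exact: measurableU.
    move=> [u v] [/=]; rewrite !in_itv /= => /andP[xu u1] /andP[v0 vy].
    have [->|ux] := eqVneq u x; first by right.
    by left; split; rewrite // u1 lt_neqAle xu eq_sym ux andbT.
  rewrite (le_trans (mass_subadd _ _ _)) // mass_line1; lra.
apply: (@le_trans _ _ (mass mu ((`[x, 1] `*` `[0, y]) `|` S))).
  apply: le_mass => //; first exact: measurableU.
  move=> [u v] [/=]; rewrite !in_itv /= => /andP[/ltW xu u1] vy.
  have [v0|v0] := leP v 0; first by right; split.
  by left; split; rewrite ?xu // (ltW v0).
by rewrite (le_trans (mass_subadd _ _ _)) // mass_below2 //; lra.
Qed.

End Mass.

Section Uniqueness.
Context (R : realType).
Implicit Types (mu nu : permuton R) (x y : R) (A B : set R).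

Lemma finite_measure_lower_unique (m1 m2 : {measure set R -> \bar R}) :
  (m1 setT < +oo)%E -> (forall x, m1 `]-oo, x]%classic = m2 `]-oo, x]%classic) ->
  forall A, measurable A -> m1 A = m2 A.
Proof.
move=> m1T m12 A mA.
have m1fin (B : set R) : measurable B -> (m1 B < +oo)%E.
  by move=> mB; apply: le_lt_trans m1T; apply: le_measure; rewrite ?inE.
have lower : forall B, ocitv B -> m1 B = m2 B.
  move=> _ [[a b] _ <-] /=; have [ba|ab] := leP b a.
    by rewrite set_itv_ge ?measure0 // bnd_simp -leNgt.
  have -> : `]a, b]%classic = `]-oo, b]%classic `\` `]-oo, a]%classic :> set R.
    apply/seteqP; split => u /=; rewrite !in_itv /=.
      by move=> /andP[au ->]; split => //; apply/negP; rewrite -ltNge.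
    by move=> [-> /negP]; rewrite -ltNge => ->.
  have aI : `]-oo, b]%classic `&` `]-oo, a]%classic = `]-oo, a]%classic :> set R.
    apply/seteqP; split => u /=; rewrite !in_itv /=; first by case.
    by move=> ua; split => //; lra.
  have fin2 : (m2 `]-oo, b]%classic < +oo)%E by rewrite -m12 m1fin.
  rewrite [LHS]measureD ?m1fin // [RHS]measureD // aI.
  by congr (_ - _)%E; exact: m12.
apply: (@measure_unique _ _ _ (@ocitv R) (fun n => `](- n%:R), n%:R]%classic)) => //.
- exact: ocitvI.
- by move=> n; exact: is_ocitv.
- apply/seteqP; split => // u _; exists (Num.truncn `|u|).+1 => //=.
  rewrite in_itv /=; have := @truncnS_gt R `|u|; rewrite ltr_norml.
  by move=> /andP[-> /ltW].
- by move=> k; exact: m1fin.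
Qed.

(** The one-dimensional uniqueness theorem is applied in each coordinate in turn:
first to the measures A -> mu (A * ]-oo, y]), then, for each measurable A, to
B -> mu (A * B). Measurable rectangles then determine the measure. *)
Lemma permuton_cdf_unique mu nu :
  (forall x y, joint_cdf mu x y = joint_cdf nu x y) -> mu = nu.
Proof.
move=> F.
have mfst : measurable_fun setT (@fst R R) by exact: measurable_fst.
have msnd : measurable_fun setT (@snd R R) by exact: measurable_snd.
have step1 A y : measurable A -> mu (A `*` `]-oo, y]) = nu (A `*` `]-oo, y]).
  move=> mA.
  have mD : measurable (setT `*` `]-oo, y] : set (R * R)) by exact: measurableX.
  have E (m : permuton R) B : m (B `*` `]-oo, y]) =
      pushforward (mrestr m mD) fst B.
    rewrite /pushforward /mrestr; congr (m _).
    by apply/seteqP; split => -[u v] /=; tauto.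
  rewrite !E; apply: finite_measure_lower_unique => //.
    rewrite -[X in (X < _)%E](E mu setT) massE ?ltry //; exact: measurableX.
  move=> x; suff : mu (`]-oo, x] `*` `]-oo, y]) = nu (`]-oo, x] `*` `]-oo, y]).
    by rewrite !E.
  rewrite !massE; [|exact: measurableX|exact: measurableX].
  by congr EFin; exact: F.
have step2 A B : measurable A -> measurable B -> mu (A `*` B) = nu (A `*` B).
  move=> mA mB.
  have mD : measurable (A `*` setT : set (R * R)) by exact: measurableX.
  have E (m : permuton R) C : m (A `*` C) = pushforward (mrestr m mD) snd C.
    rewrite /pushforward /mrestr; congr (m _).
    by apply/seteqP; split => -[u v] /=; tauto.
  rewrite !E; apply: finite_measure_lower_unique => //.
    rewrite -[X in (X < _)%E](E mu setT) massE ?ltry //; exact: measurableX.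
  by move=> x; have := step1 A x mA; rewrite !E.
apply: permuton_eq => A mA.
apply: (@measure_unique _ _ _ [set A `*` B | A in measurable & B in measurable]
   (fun=> setT)) => //.
- exact: measurable_prod_measurableType.
- move=> _ _ [A1 mA1 [B1 mB1 <-]] [A2 mA2 [B2 mB2 <-]].
  by rewrite -setXI; exists (A1 `&` A2); [exact: measurableI|
    exists (B1 `&` B2) => //; exact: measurableI].
- by move=> _; exists setT => //; exists setT => //; rewrite setXTT.
- by rewrite bigcup_const.
- by move=> _ [A1 mA1 [B1 mB1 <-]]; exact: step2.
- by move=> _; rewrite -ge0_fin_numE // fin_num_measure.
Qed.

(** The projection of the line onto [0, 1]; it reduces a distribution function to
its values on the unit square. *)
Definition clamp x : R := Num.max 0 (Num.min x 1).

Lemma clamp01 x : 0 <= clamp x <= 1.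
Proof. by rewrite /clamp le_max lexx ge_max ge_min lexx orbT ler01. Qed.

Lemma joint_cdf_clamp mu x y : joint_cdf mu x y = joint_cdf mu (clamp x) (clamp y).
Proof.
transitivity (joint_cdf mu (clamp x) y); rewrite /joint_cdf /clamp.
  case: (leP x 1) => x1; [case: (leP 0 x) => x0 //|].
    by rewrite !mass_below1 // ltW.
  rewrite max_r // -[LHS](subrK (mass mu (`]-oo, 1] `*` `]-oo, y]))).
  rewrite -mass_strip1 //; last exact: ltW.
  rewrite (_ : mass _ _ = 0) ?add0r //; apply: le_anti; rewrite mass_ge0 andbT.
  rewrite -(@mass_beyond1 _ mu `]-oo, y]%classic) //.
  apply: le_mass; [exact: measurableX|exact: measurableX|].
  by move=> [u v] [/=]; rewrite !in_itv /= => /andP[-> _].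
move: (Num.max 0 (Num.min x 1)) => z.
case: (leP y 1) => y1; [case: (leP 0 y) => y0 //|].
  by rewrite !mass_below2 // ltW.
have mA : measurable (`]-oo, z]%classic : set R) by exact: measurable_itv.
rewrite max_r // -[LHS](subrK (mass mu (`]-oo, z] `*` `]-oo, 1]))).
rewrite -mass_strip2 //; last exact: ltW.
rewrite (_ : mass _ _ = 0) ?add0r //; apply: le_anti; rewrite mass_ge0 andbT.
rewrite -(mass_beyond2 mu mA) //.
apply: le_mass; [exact: measurableX|exact: measurableX|].
by move=> [u v] [/=]; rewrite !in_itv /= => ? /andP[-> _].
Qed.

Lemma permuton_cdf_eq mu nu :
  (forall x y, 0 <= x <= 1 -> 0 <= y <= 1 -> joint_cdf mu x y = joint_cdf nu x y) ->
  mu = nu.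
Proof.
move=> F; apply: permuton_cdf_unique => x y.
by rewrite joint_cdf_clamp [RHS]joint_cdf_clamp; apply: F; exact: clamp01.
Qed.

End Uniqueness.

(** * Avoiding the pattern 231 *)

Section Pattern.
Context (R : realType).
Implicit Types (mu nu : permuton R) (x y : R) (A B : set R).

Lemma mass_upper1 mu b B : measurable B ->
  mass mu (`]b, +oo[ `*` B) = mass mu (setT `*` B) - mass mu (`]-oo, b] `*` B).
Proof.
move=> mB; apply/eqP; rewrite eq_sym subr_eq; apply/eqP.
apply: mass_split; [exact: measurableX|exact: measurableX| |] => -[u v] /=;
  rewrite !in_itv /= ?andbT; last by move=> [] ? ? []; lra.
split; last by move=> [] [].
by move=> [_ Bv]; have [ub|ub] := leP u b; [right|left].
Qed.

Lemma mass_upper2 mu d A : measurable A ->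
  mass mu (A `*` `]d, +oo[) = mass mu (A `*` setT) - mass mu (A `*` `]-oo, d]).
Proof.
move=> mA; apply/eqP; rewrite eq_sym subr_eq; apply/eqP.
apply: mass_split; [exact: measurableX|exact: measurableX| |] => -[u v] /=;
  rewrite !in_itv /= ?andbT; last by move=> [] ? ? []; lra.
split; last by move=> [] [].
by move=> [Au _]; have [vd|vd] := leP v d; [right|left].
Qed.

Lemma clamp_id x : 0 <= x <= 1 -> clamp x = x.
Proof. by move=> /andP[x0 x1]; rewrite /clamp min_l // max_r. Qed.

Lemma clamp_mono : {homo @clamp R : x y / x <= y}.
Proof.
move=> x y xy; rewrite /clamp ge_max le_max lexx /= le_max.
by rewrite le_min !ge_min xy lexx !orbT.
Qed.

Lemma mass_lower1_clamp mu x : mass mu (`]-oo, x] `*` setT) = clamp x.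
Proof.
have c1 : clamp 1 = 1 :> R by rewrite clamp_id ?ler01 ?lexx.
rewrite mass_cut2 // -/(joint_cdf mu x 1) joint_cdf_clamp c1.
exact: joint_cdf_top (clamp01 x).
Qed.

Lemma mass_lower2_clamp mu y : mass mu (setT `*` `]-oo, y]) = clamp y.
Proof.
have c1 : clamp 1 = 1 :> R by rewrite clamp_id ?ler01 ?lexx.
rewrite mass_cut1 // -/(joint_cdf mu 1 y) joint_cdf_clamp c1.
exact: joint_cdf_right (clamp01 y).
Qed.

(** All the triples that realise the pattern 231 and are separated by the lines
x = a, x = b, y = c, y = d. Half-open sides make the masses of the three factors
differences of values of the distribution function. *)
Definition box231 (a b c d : R) : set ((R * R) * (R * R) * (R * R)) :=
  ((`]-oo, a] `*` `]c, d]) `*` (`]a, b] `*` `]d, +oo[)) `*` (`]b, +oo[ `*` `]-oo, c]).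

Lemma measurable_box231 a b c d : measurable (box231 a b c d).
Proof. by rewrite /box231; do ![apply: measurableX => //]. Qed.

Lemma box231_sub a b c d : box231 a b c d `<=` @occ231 R.
Proof.
move=> [[[x1 y1] [x2 y2]] [x3 y3]]; rewrite /box231 /occ231 /=.
rewrite !in_itv /= !andbT.
by move=> [[[? /andP[? ?]] [/andP[? ?] ?]] [? ?]]; split; lra.
Qed.

Definition rat_box231 (n : nat) : set ((R * R) * (R * R) * (R * R)) :=
  if @unpickle (rat * rat * rat * rat)%type n is Some (a, b, c, d)
  then box231 (ratr a) (ratr b) (ratr c) (ratr d) else set0.

Lemma occ231_bigcup : @occ231 R = \bigcup_n rat_box231 n.
Proof.
apply/seteqP; split; last first.
  move=> p [n _]; rewrite /rat_box231.
  by case: unpickle => [[[[a b] c] d]|//]; exact: box231_sub.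
move=> [[[x1 y1] [x2 y2]] [x3 y3]] /= [x12 x23 y31 y12].
have [a] := rat_in_itvoo x12; rewrite in_itv /= => /andP[a1 a2].
have [b] := rat_in_itvoo x23; rewrite in_itv /= => /andP[b1 b2].
have [c] := rat_in_itvoo y31; rewrite in_itv /= => /andP[c1 c2].
have [d] := rat_in_itvoo y12; rewrite in_itv /= => /andP[d1 d2].
exists (pickle (a, b, c, d)); first exact: Logic.I.
rewrite /rat_box231 pickleK /box231 /= !in_itv /= !andbT.
by rewrite (ltW a1) a2 (ltW b1) b2 c2 (ltW d1) d2 (ltW c1).
Qed.

Lemma measurable_rat_box231 n : measurable (rat_box231 n).
Proof.
rewrite /rat_box231.
by case: unpickle => [[[[a b] c] d]|//]; exact: measurable_box231.
Qed.

Lemma measurable_occ231 : measurable (@occ231 R).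
Proof.
by rewrite occ231_bigcup; apply: bigcupT_measurable; exact: measurable_rat_box231.
Qed.

Lemma box231_mass mu a b c d :
  ((mu \x mu) \x mu)%E (box231 a b c d) =
  (mass mu (`]-oo, a] `*` `]c, d]) * mass mu (`]a, b] `*` `]d, +oo[) *
   mass mu (`]b, +oo[ `*` `]-oo, c]))%:E.
Proof.
have m1 : measurable (`]-oo, a] `*` `]c, d] : set (R * R)) by exact: measurableX.
have m2 : measurable (`]a, b] `*` `]d, +oo[ : set (R * R)) by exact: measurableX.
have m3 : measurable (`]b, +oo[ `*` `]-oo, c] : set (R * R)) by exact: measurableX.
rewrite !EFinM -!massE //.
apply: etrans (product_measure1E (mu \x mu)%E mu (measurableX m1 m2) m3) _.
by congr (_ * _)%E; exact: product_measure1E.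
Qed.

(** The occurrences of 231 are a countable union of boxes, each of which is a
product set, so the triple product measure reduces to masses of rectangles. *)
Lemma Av231_boxes mu :
  (Av231 mu) <-> forall a b c d,
     mass mu (`]-oo, a] `*` `]c, d]) * mass mu (`]a, b] `*` `]d, +oo[) *
     mass mu (`]b, +oo[ `*` `]-oo, c]) = 0.
Proof.
split=> [av a b c d|boxes].
  apply: EFin_inj; rewrite -box231_mass; apply/eqP; rewrite -measure_le0 -av.
  apply: le_measure; rewrite ?inE; [exact: measurable_box231|
    exact: measurable_occ231|exact: box231_sub].
rewrite /Av231 /= occ231_bigcup.
have : ((mu \x mu) \x mu)%E.-negligible (\bigcup_n rat_box231 n).
  apply: negligible_bigcup => n; apply/negligibleP.
    exact: measurable_rat_box231.
  rewrite /rat_box231; case: unpickle => [[[[a b] c] d]|]; last exact: measure0.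
  by apply: etrans (box231_mass _ _ _ _ _) _; rewrite boxes.
move/negligibleP; apply; apply: bigcupT_measurable.
exact: measurable_rat_box231.
Qed.

Lemma stack_cdf_Av231 mu (phi : @unit_interval R -> R) : excursion_function phi ->
  (forall x y, 0 <= x <= 1 -> 0 <= y <= 1 -> joint_cdf mu x y = stack_cdf phi x y) ->
  Av231 mu.
Proof.
move=> ephi F; apply/Av231_boxes => a b c d.
have FE x y : mass mu (`]-oo, x] `*` `]-oo, y]) = stack_cdf phi (clamp x) (clamp y).
  by rewrite -[LHS]/(joint_cdf mu x y) joint_cdf_clamp F // clamp01.
have [ba|/ltW ab] := leP b a.
  rewrite (_ : `]a, b]%classic = set0) ?set0X /mass ?measure0 ?mulr0 ?mul0r //.
  by rewrite set_itv_ge // bnd_simp -leNgt.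
have [dc|/ltW cd] := leP d c.
  rewrite (_ : `]c, d]%classic = set0) ?setX0 /mass ?measure0 ?mul0r //.
  by rewrite set_itv_ge // bnd_simp -leNgt.
rewrite mass_upper1 // mass_lower2_clamp mass_upper2 // mass_strip1 //.
rewrite !mass_lower1_clamp mass_strip1 // mass_strip2 // !FE.
have [-> | E | ->] := stack_cdf_av231 phi (clamp_mono ab) (clamp_mono cd).
- by rewrite subrr mulr0.
- by rewrite [X in _ * X * _](_ : _ = 0) ?mulr0 ?mul0r //; lra.
- by rewrite subrr !mul0r.
Qed.

End Pattern.

(** * From permutons to excursions *)

Section LeftValue.
Context (R : realType).

(** The properties of RLM-curves that yield an excursion. The last one is right
continuity, in the form it takes for nondecreasing functions. *)
Record rlm_curve_like (f : R -> R) : Prop := {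
  curve_ge0 : forall x, 0 <= x <= 1 -> 0 <= f x;
  curve_le : forall x, 0 <= x <= 1 -> f x <= x;
  curve_mono : forall x x', 0 <= x -> x <= x' -> x' <= 1 -> f x <= f x';
  curve1 : f 1 = 1;
  curve_right : forall x y, 0 <= x <= 1 -> 0 <= y <= 1 ->
    (forall e, 0 < e -> exists x', [/\ x <= x', x' <= 1, x' <= x + e & y - e <= f x']) ->
    y <= f x }.

Variable f : R -> R.
Hypothesis cf : rlm_curve_like f.

Lemma left_cvg x : 0 < x <= 1 -> cvg (f y @[y --> x^'-]).
Proof.
move=> /andP[x0 x1].
apply: nondecreasing_at_left_is_cvgr.
  near=> z; have z0 : 0 < z by near: z; exact: nbhs_left_gt.
  move=> a b; rewrite !in_itv /= => /andP[za ax] /andP[zb bx] ab.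
  by apply: curve_mono => //; lra.
near=> z; have z0 : 0 < z by near: z; exact: nbhs_left_gt.
exists 1 => _ [a aI <-]; move: aI; rewrite /= in_itv /= => /andP[za ax].
by have := @curve_le _ cf a; lra.
Unshelve. all: by end_near. Qed.

Lemma left_value_ge x x' : 0 <= x' -> x' < x -> x <= 1 -> f x' <= left_value f x.
Proof.
move=> x'0 x'x x1; rewrite /left_value gt_eqF; last by lra.
apply: limr_ge; first by apply: left_cvg; lra.
near=> z.
have zx' : x' < z by near: z; exact: nbhs_left_gt.
have zx : z < x by near: z; exact: nbhs_left_lt.
by apply: curve_mono => //; lra.
Unshelve. all: by end_near. Qed.

Lemma left_value_le x c : 0 <= x <= 1 -> 0 <= c ->
  (forall x', 0 <= x' -> x' < x -> f x' <= c) -> left_value f x <= c.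
Proof.
move=> x01 c0 h; rewrite /left_value; case: eqVneq => // x_neq0.
have x0 : 0 < x by rewrite lt_neqAle eq_sym x_neq0; lra.
apply: limr_le; first by apply: left_cvg; lra.
near=> z; apply: h.
  by apply: ltW; near: z; exact: nbhs_left_gt.
by near: z; exact: nbhs_left_lt.
Unshelve. all: by end_near. Qed.

Lemma left_value_le_curve x : 0 <= x <= 1 -> left_value f x <= f x.
Proof.
move=> x01; apply: left_value_le => //; first exact: (curve_ge0 cf).
by move=> x' x'0 x'x; apply: curve_mono => //; lra.
Qed.

Lemma completed_graphP x y : completed_graph f (x, y) <->
  [/\ 0 <= x <= 1, 0 <= y <= 1, left_value f x <= y & y <= f x].
Proof.
rewrite /completed_graph /unit_square /unit_interval /= !in_itv /=.
by split=> [[[-> ->] /andP[-> ->]]|[-> -> -> ->]].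
Qed.

(** Points of the completed graph are comparable: this is what makes the excursion
1-Lipschitz, and its graph unique on each antidiagonal. *)
Lemma completed_graph_chain x y x' y' :
  completed_graph f (x, y) -> completed_graph f (x', y') -> x < x' -> y <= y'.
Proof.
move=> /completed_graphP[x01 y01 _ yf] /completed_graphP[x'01 y'01 ly' _] xx'.
have : f x <= left_value f x' by apply: left_value_ge; lra.
by lra.
Qed.

(** The points (t + h, t - h) of the antidiagonal through (t, t) that lie on or
below the curve; the excursion at t is the infimum of these h. *)
Let crossing t : set R := [set h | 0 <= h <= 1 - t /\ t - h <= f (t + h)].

Let inf_crossing t : 0 <= t <= 1 ->
  completed_graph f (t + inf (crossing t), t - inf (crossing t)).
Proof.
move=> t01; set h := inf _.
have hlb : has_lbound (crossing t) by exists 0 => ? [/andP[]].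
have h1 : crossing t (1 - t).
  by split; [lra|rewrite [t + (1 - t)](_ : _ = 1) ?(curve1 cf); lra].
have hS : has_inf (crossing t) by split => //; exists (1 - t).
have h0 : 0 <= h by apply: lb_le_inf; [exists (1 - t)|move=> ? [/andP[]]].
have ht1 : h <= 1 - t by exact: ge_inf.
have ht : h <= t.
  have [tt|tt] := leP t (1 - t); last by lra.
  by apply: ge_inf => //; split; [lra|rewrite subrr; apply: (curve_ge0 cf); lra].
have below k : 0 <= k -> k < h -> f (t + k) < t - k.
  move=> k0 kh; rewrite ltNge; apply/negP => fk.
  suff : h <= k by lra.
  by apply: ge_inf => //; split => //; lra.
apply/completed_graphP; split; [lra|lra| |].
  apply: left_value_le => //; [lra|lra|] => x' x'0 x'h.
  rewrite leNgt; apply/negP => lt_f.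
  have [h0'|h0'] := leP h 0.
    by have := @curve_le _ cf x'; lra.
  pose k := Num.max 0 (Num.max (x' - t) (t - f x')).
  have k0 : 0 <= k by rewrite /k le_max lexx.
  have k1 : x' - t <= k by rewrite /k !le_max lexx orbT.
  have k2 : t - f x' <= k by rewrite /k !le_max lexx !orbT.
  have kh : k < h by rewrite /k !gt_max h0'; lra.
  have := below k k0 kh.
  have : f x' <= f (t + k) by apply: curve_mono => //; lra.
  by lra.
apply: (curve_right cf); [lra|lra|] => e e0.
have [k Sk kh] := inf_adherent e0 hS; have [/andP[k0 k1] fk] := Sk.
exists (t + k); have hk : h <= k by exact: ge_inf.
by split; rewrite -/h in kh; lra.
Qed.

Lemma exists_excursion :
  exists phi : @unit_interval R -> R, excursion_function phi /\ is_excursion f phi.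
Proof.
pose phi (r : @unit_interval R) := inf (crossing (val r)).
have gr r : completed_graph f (val r + phi r, val r - phi r).
  by apply: inf_crossing; exact: unit_val.
exists phi; split.
  split.
  - have mono s t : val s <= val t -> `|phi s - phi t| <= `|val s - val t|.
      move=> st; rewrite (ler0_norm (_ : val s - val t <= 0)); last by lra.
      rewrite ler_norml; apply/andP; split; rewrite leNgt; apply/negP => lt_st.
        have := completed_graph_chain (gr s) (gr t); lra.
      have := completed_graph_chain (gr t) (gr s); lra.
    move=> s t; have [/mono//|/ltW/mono] := leP (val s) (val t).
    by rewrite distrC (distrC (val t)).
  - move=> t; have /completed_graphP[x01 _ _ yf] := gr t.
    by have := @curve_le _ cf (val t + phi t); lra.
  - move=> t t01; have /completed_graphP[x01 y01 _ yf] := gr t.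
    have := @curve_le _ cf (val t + phi t).
    by case: t01 => tE; rewrite tE in x01 y01 yf *; lra.
apply/seteqP; split; last by move=> _ [t _ <-]; exact: gr.
move=> [x y] xy; have /completed_graphP[x01 y01 ly yf] := xy.
have [|t tE] := @unit_pt R ((x + y) / 2); first by lra.
have yx : y <= x by have := @curve_le _ cf x; lra.
suff E : phi t = (x - y) / 2 by exists t => //; rewrite E tE; congr pair; lra.
have Pt := gr t; have /completed_graphP[x01' y01' ly' yf'] := Pt.
have [lt1|lt2|//] := ltgtP (phi t) ((x - y) / 2).
  by have := completed_graph_chain Pt xy; lra.
exfalso; suff : phi t <= (x - y) / 2 by lra.
apply: ge_inf; first by exists 0 => ? [/andP[]].
split; first by lra.
have -> : val t - (x - y) / 2 = y by lra.
by have -> : val t + (x - y) / 2 = x by lra.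
Qed.

End LeftValue.

Section RlmCurve.
Context (R : realType) (mu : permuton R).
Local Notation f := (rlm_curve mu).
Implicit Types x y : R.

Lemma rlm_setP x y : 0 <= x <= 1 ->
  rlm_set mu x y <-> 0 <= y <= 1 /\ joint_cdf mu x y = y.
Proof.
move=> x01; split=> -[y01 E]; split => //; have := rlm_mass mu x01 y01.
  by rewrite /mass E /=; lra.
rewrite E subrr => m0; rewrite massE ?m0 //; exact: measurableX.
Qed.

Lemma joint_cdf_rlm_curve x : 0 <= x <= 1 ->
  0 <= f x <= 1 /\ joint_cdf mu x (f x) = f x.
Proof. by move=> x01; apply/rlm_setP => //; case: (rlm_curve_max mu x). Qed.

(** The equation on the right says that the whole strip of heights up to y, of mass
y, lies left of x. *)
Lemma le_rlm_curve x y : 0 <= x <= 1 -> 0 <= y <= 1 ->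
  y <= f x <-> joint_cdf mu x y = y.
Proof.
move=> x01 y01; split=> [yf|E]; last first.
  by have [_] := rlm_curve_max mu x; apply; apply/rlm_setP.
have [f01 E] := joint_cdf_rlm_curve x01.
have := @joint_cdf_incr2 _ mu x y (f x); rewrite E.
by have := joint_cdf_le2 mu x y01; lra.
Qed.

Lemma rlm_curve_is_curve : rlm_curve_like f.
Proof.
split.
- by move=> x /joint_cdf_rlm_curve[]; lra.
- move=> x x01; have [f01 <-] := joint_cdf_rlm_curve x01.
  exact: joint_cdf_le1.
- move=> x x' x0 xx' x'1; have [|f01 E] := @joint_cdf_rlm_curve x; [lra|].
  apply/le_rlm_curve => //; first by lra.
  have := @joint_cdf_incr1 _ mu x x' (f x) x0 xx' x'1.
  by have := joint_cdf_le2 mu x' f01; lra.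
- have [|f01 E] := @joint_cdf_rlm_curve 1; [lra|].
  apply: le_anti; rewrite (andP f01).2 /=.
  by apply/le_rlm_curve; rewrite ?joint_cdf_right ?ler01 ?lexx.
- move=> x y x01 y01 h; apply/le_rlm_curve => //.
  apply: le_anti; rewrite joint_cdf_le2 //=; apply/ler_addgt0Pr => e e0.
  have [|x' [xx' x'1 x'e yf]] := h (e / 2); first by lra.
  have [z [z0 zy yz zf]] : exists z, [/\ 0 <= z, z <= y, y - e / 2 <= z & z <= f x'].
    have [y0|y0] := leP 0 (y - e / 2); first by exists (y - e / 2); split; lra.
    by exists 0; have [|f01 _] := @joint_cdf_rlm_curve x'; [lra|split; lra].
  have : joint_cdf mu x' z = z by apply/le_rlm_curve => //; lra.
  have := @joint_cdf_incr1 _ mu x x' z; have := @joint_cdf_incr2 _ mu x z y.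
  by lra.
Qed.

Let cf := rlm_curve_is_curve.

(** Each path point (X, Y) is on or below the curve, so the mass of
[0, X] * [0, z] is z for all z <= Y; passing from X to x loses at most X - x. *)
Lemma stack_cdf_le_joint_cdf phi x y : is_excursion f phi ->
  0 <= x <= 1 -> 0 <= y <= 1 -> stack_cdf phi x y <= joint_cdf mu x y.
Proof.
move=> ephi x01 y01; apply: stack_cdf_le => r b b1 b2 b3 b4.
have : completed_graph f (path_x phi r, path_y phi r).
  by rewrite ephi; exists r.
move=> /completed_graphP[X01 Y01 _ Yf].
move: (path_x phi r) (path_y phi r) => X Y in b1 b2 b3 b4 X01 Y01 Yf *.
have [z [z01 zY zy bz bz']] : exists z,
    [/\ 0 <= z <= 1, z <= Y, z <= y, b <= z & b <= z - (X - x)].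
  have [Yy|yY] := leP Y y; [by exists Y; split; lra|by exists y; split; lra].
have E : joint_cdf mu X z = z by apply/le_rlm_curve => //; lra.
have := @joint_cdf_incr2 _ mu x z y.
have [Xx|xX] := leP X x.
  by have := @joint_cdf_incr1 _ mu X x z; lra.
by have := @joint_cdf_incr1 _ mu x X z; lra.
Qed.

(** Let y' be the largest height that the mass of [0, x] * [0, y] really uses, and
X the first abscissa where the curve reaches y'. Mass in ]x, X[ * ]y', 1] would
form the pattern 231 with mass just below y' on the left of x and mass still
lower on the right of it; the latter exists because the curve is below y' before
X. Hence all the mass over ]x, X] has height at most y', and the distribution
function at (x, y) is y' - (X - x), the path bound of the point (X, y') of the
completed graph. *)
Lemma joint_cdf_le_stack_cdf phi x y : Av231 mu -> is_excursion f phi ->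
  0 <= x <= 1 -> 0 <= y <= 1 -> joint_cdf mu x y <= stack_cdf phi x y.
Proof.
move=> av ephi x01 y01.
have path X Y : [/\ 0 <= X <= 1, 0 <= Y <= 1, left_value f X <= Y & Y <= f X] ->
    exists r, path_x phi r = X /\ path_y phi r = Y.
  move=> /completed_graphP; rewrite ephi => -[r _ [rX rY]].
  by exists r.
have [fx01 fxE] := joint_cdf_rlm_curve x01.
have low z : z <= y -> z <= f x -> z <= stack_cdf phi x y.
  move=> zy zf; have [|r [rX rY]] := path x (f x).
    by split => //; exact: (left_value_le_curve cf).
  by apply: (@stack_cdf_ge _ _ _ _ r); lra.
pose V := [set v | 0 <= v <= y /\ joint_cdf mu x y <= joint_cdf mu x v].
have Vy : V y by split => //; lra.
have Vlb : has_lbound V by exists 0 => v [/andP[]].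
have Vinf : has_inf V by split => //; exists y.
pose y' := inf V.
have y'y : y' <= y by exact: ge_inf.
have y'0 : 0 <= y' by apply: lb_le_inf; [exists y|move=> v [/andP[]]].
have y'E : joint_cdf mu x y' = joint_cdf mu x y.
  have := @joint_cdf_incr2 _ mu x y' y => /(_ y'0 y'y) incr.
  suff : joint_cdf mu x y <= joint_cdf mu x y' by lra.
  apply/ler_addgt0Pr => e e0; have [v Vv ve] := inf_adherent e0 Vinf; have [v0y vE] := Vv.
  have y'v : y' <= v by apply: ge_inf.
  have := @joint_cdf_incr2 _ mu x y' v; rewrite -/y' in ve.
  by lra.
have y'min v : 0 <= v -> v < y' -> joint_cdf mu x v < joint_cdf mu x y.
  move=> v0 vy'; rewrite ltNge; apply/negP => le_v.
  suff : y' <= v by lra.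
  by apply: ge_inf => //; split => //; lra.
(* The ordinate y' is at most that of the curve at x: the point of the curve
   over x is the required path point. *)
have [y'f|fy'] := leP y' (f x).
  by rewrite -y'E; apply: low; have := @joint_cdf_le2 _ mu x y'; lra.
pose W := [set X | x <= X <= 1 /\ y' <= f X].
have W1 : W 1 by split; [lra|rewrite (curve1 cf); lra].
have Wlb : has_lbound W by exists x => X [/andP[]].
have Winf : has_inf W by split => //; exists 1.
pose X := inf W.
have X1 : X <= 1 by exact: ge_inf.
have xX : x <= X by apply: lb_le_inf; [exists 1|move=> v [/andP[]]].
have Xf : y' <= f X.
  apply: (curve_right cf); [lra|lra|] => e e0.
  have [x' Wx' x'e] := inf_adherent e0 Winf; have [x'1 fx'] := Wx'.
  have Xx' : X <= x' by apply: ge_inf.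
  by exists x'; rewrite -/X in x'e; split; lra.
have Xmin x' : 0 <= x' -> x' < X -> f x' < y'.
  move=> x'0 x'X; have [xx'|x'x] := leP x x'; last first.
    by have := @curve_mono _ f cf x' x; lra.
  rewrite ltNge; apply/negP => le_f.
  suff : X <= x' by lra.
  by apply: ge_inf => //; split => //; lra.
have [|r [rX rY]] := path X y'.
  split; [lra|lra| |by []]; apply: (left_value_le cf); [lra|lra|].
  by move=> x' x'0 x'X; apply: ltW; exact: Xmin.
have XE : joint_cdf mu X y' = y' by apply/le_rlm_curve => //; lra.
(* X - x is the whole mass over ]x, X]: the inequality says that none of
   it is above y'. *)
suff key : joint_cdf mu X y' - joint_cdf mu x y' >= X - x.
  by rewrite -y'E; apply: (@stack_cdf_ge _ _ _ _ r); lra.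
rewrite leNgt; apply/negP => gap.
pose d := X - x - (joint_cdf mu X y' - joint_cdf mu x y').
(* The offending mass d survives when X is moved left by d / 2, where the curve
   is strictly below y'. *)
pose x2 := Num.max x (X - d / 2).
have x2x : x <= x2 by rewrite /x2 le_max lexx.
have x2d : X - d / 2 <= x2 by rewrite /x2 le_max lexx orbT.
have [x2X|Xx2] := ltP x2 X; last first.
  move: Xx2; rewrite /x2 le_max /d => /orP[]; last by lra.
  move=> Xx; have XxE : X = x by lra.
  by move: gap; rewrite XxE; lra.
have fx2 := Xmin x2 _ x2X; have [|f201 f2E] := @joint_cdf_rlm_curve x2; [lra|].
pose v := (f x2 + y') / 2.
have v01 : 0 <= v <= 1 by rewrite /v; lra.
have vy' : v < y' by rewrite /v; lra.
have Fv : joint_cdf mu x2 v < v.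
  rewrite lt_neqAle joint_cdf_le2 // andbT; apply/eqP => /le_rlm_curve.
  by rewrite /v; lra.
have := (Av231_boxes mu).1 av x x2 v y'.
apply/eqP; rewrite !mulf_neq0 //.
- rewrite mass_strip2 //; last exact: ltW.
  rewrite -/(joint_cdf mu x y') -/(joint_cdf mu x v).
  by have := y'min v; lra.
- rewrite mass_upper2 // !mass_strip1 // !mass_lower1_clamp !clamp_id; [|lra..].
  rewrite -/(joint_cdf mu x2 y') -/(joint_cdf mu x y').
  have := @joint_cdf_incr1 _ mu x2 X y'; rewrite /d in x2d; lra.
- rewrite mass_upper1 // mass_lower2_clamp clamp_id // -/(joint_cdf mu x2 v).
  by lra.
Qed.

Lemma joint_cdf_stack_cdf phi x y : Av231 mu -> is_excursion f phi ->
  0 <= x <= 1 -> 0 <= y <= 1 -> joint_cdf mu x y = stack_cdf phi x y.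
Proof.
move=> av ephi x01 y01; apply: le_anti.
by rewrite joint_cdf_le_stack_cdf ?stack_cdf_le_joint_cdf.
Qed.

End RlmCurve.

(** * From copulas to permutons *)

Lemma exists_half_exp (R : realType) (e : R) : 0 < e -> exists n, 2^-1 ^+ n < e.
Proof.
move=> e0; have [n _ /(_ n)] := near_infty_natSinv_expn_lt (PosNum e0).
by rewrite div1r -exprVn => /(_ (leqnn n)); exists n.
Qed.

Section Copula.
Context (R : realType) (C : R -> R -> R).
Implicit Types x y u : R.

(** The mass that a measure with distribution function [C] gives to
]a, b] * ]c, d]. *)
Definition volume a b c d := C b d - C a d - C b c + C a c.

(** A cell of the halving tree: the rectangle ]a, b] * ]c, d], the left end of the
interval of [0, 1[ that is assigned to it (of length the volume of the
rectangle), and the direction of the next cut. *)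
Record cell := Cell {
  cell_a : R; cell_b : R; cell_c : R; cell_d : R; cell_start : R; cell_dir : bool }.

Definition cell_mass (Q : cell) :=
  volume (cell_a Q) (cell_b Q) (cell_c Q) (cell_d Q).

Definition cell_low (Q : cell) : cell :=
  let: Cell a b c d s p := Q in
  if p then Cell a ((a + b) / 2) c d s false else Cell a b c ((c + d) / 2) s true.

Definition cell_high (Q : cell) : cell :=
  let: Cell a b c d s p := Q in
  let s' := s + cell_mass (cell_low Q) in
  if p then Cell ((a + b) / 2) b c d s' false else Cell a b ((c + d) / 2) d s' true.

Definition cell_step u Q : cell :=
  if u < cell_start Q + cell_mass (cell_low Q) then cell_low Q else cell_high Q.

(** For u in [0, 1[, the cell of depth n whose interval contains u. *)
Definition cell_at u n := iter n (cell_step u) (Cell 0 1 0 1 0 true).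

Definition limit_x u := sup (range (fun n => cell_a (cell_at u n))).
Definition limit_y u := sup (range (fun n => cell_c (cell_at u n))).

Definition cell_valid Q :=
  cell_a Q <= cell_b Q /\ cell_c Q <= cell_d Q.

Definition cell_sub Q Q' :=
  [/\ cell_a Q' <= cell_a Q, cell_b Q <= cell_b Q',
      cell_c Q' <= cell_c Q & cell_d Q <= cell_d Q'].

Lemma cell_low_valid Q : cell_valid Q -> cell_valid (cell_low Q) /\ cell_sub (cell_low Q) Q.
Proof.
by case: Q => a b c d s [] [/= ab cd]; rewrite /cell_valid /cell_sub /=;
  do ![split]; lra.
Qed.

Lemma cell_high_valid Q : cell_valid Q -> cell_valid (cell_high Q) /\ cell_sub (cell_high Q) Q.
Proof.
by case: Q => a b c d s [] [/= ab cd]; rewrite /cell_valid /cell_sub /=;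
  do ![split]; lra.
Qed.

Lemma cell_mass_split Q : cell_mass Q = cell_mass (cell_low Q) + cell_mass (cell_high Q).
Proof.
by case: Q => a b c d s []; rewrite /cell_mass /volume /=; lra.
Qed.

(** The volume of the part of the cell that lies in ]-oo, x] * ]-oo, y]. *)
Definition part_mass x y Q :=
  volume (Num.min (cell_a Q) x) (Num.min (cell_b Q) x)
         (Num.min (cell_c Q) y) (Num.min (cell_d Q) y).

Lemma part_mass_split x y Q :
  part_mass x y Q = part_mass x y (cell_low Q) + part_mass x y (cell_high Q).
Proof.
by case: Q => a b c d s []; rewrite /part_mass /volume /=; lra.
Qed.

Lemma cell_at_valid u n : cell_valid (cell_at u n).
Proof.
elim: n => [|n IH]; first by split => /=; lra.
rewrite /cell_at iterS -/(cell_at u n) /cell_step.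
by case: ifP => _; [have [] := cell_low_valid IH|have [] := cell_high_valid IH].
Qed.

Lemma cell_at_sub u m n : (m <= n)%N -> cell_sub (cell_at u n) (cell_at u m).
Proof.
elim: n => [|n IH]; first by rewrite leqn0 => /eqP ->; split.
rewrite leq_eqVlt => /orP[/eqP -> //|].
rewrite ltnS => /IH[? ? ? ?].
suff [? ? ? ?] : cell_sub (cell_at u n.+1) (cell_at u n) by split; lra.
rewrite {1}/cell_at iterS -/(cell_at u n) /cell_step; have IV := cell_at_valid u n.
by case: ifP => _; [have [] := cell_low_valid IV|have [] := cell_high_valid IV].
Qed.

Lemma cell_at_width u n : let Q := cell_at u n.*2 in
  [/\ cell_b Q - cell_a Q = 2^-1 ^+ n, cell_d Q - cell_c Q = 2^-1 ^+ n & cell_dir Q].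
Proof.
elim: n => [|n]; first by rewrite expr0 /=; split => //; lra.
rewrite doubleS exprS /cell_at !iterS -/(cell_at u n.*2); move: (2^-1 ^+ n) => e.
case: (cell_at u n.*2) => a b c d s [] [/= h1 h2 //] _.
rewrite [cell_step u (Cell _ _ _ _ _ true)]/cell_step.
case: ifP => _ /=; rewrite /cell_step; case: ifP => _ /=; split => //; lra.
Qed.

Lemma cell_at_limit u n : let Q := cell_at u n in
  cell_a Q <= limit_x u <= cell_b Q /\ cell_c Q <= limit_y u <= cell_d Q.
Proof.
have h m : cell_a (cell_at u m) <= cell_b (cell_at u n) /\
    cell_c (cell_at u m) <= cell_d (cell_at u n).
  have [mn|/ltnW nm] := leqP m n.
    by have [] := cell_at_sub u mn; have [] := cell_at_valid u n; lra.
  by have [] := cell_at_sub u nm; have [] := cell_at_valid u m; lra.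
split; apply/andP; split.
- apply: ub_le_sup; last by exists n.
  by exists (cell_b (cell_at u n)) => _ [m _ <-]; have [] := h m.
- apply: ge_sup => [|_ [m _ <-]]; last by have [] := h m.
  by exists (cell_a (cell_at u n)); exists n.
- apply: ub_le_sup; last by exists n.
  by exists (cell_d (cell_at u n)) => _ [m _ <-]; have [] := h m.
- apply: ge_sup => [|_ [m _ <-]]; last by have [] := h m.
  by exists (cell_c (cell_at u n)); exists n.
Qed.

(** The cell reached from Q after n steps is a step function of u. *)
Lemma measurable_cell_iter (P : cell -> Prop) n Q :
  measurable [set u | P (iter n (cell_step u) Q)].
Proof.
elim: n Q => [|n IH] Q.
  by have [PQ|PQ] := pselect (P Q); [rewrite (_ : mkset _ = setT)|
    rewrite (_ : mkset _ = set0)] => //; apply/seteqP; split.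
pose t := cell_start Q + cell_mass (cell_low Q).
rewrite (_ : mkset _ =
  (`]-oo, t[ `&` [set u | P (iter n (cell_step u) (cell_low Q))]) `|`
  (`[t, +oo[ `&` [set u | P (iter n (cell_step u) (cell_high Q))])).
  by apply: measurableU; apply: measurableI => //; exact: measurable_itv.
apply/seteqP; split => u; rewrite /setU /setI /mkset iterSr /cell_step -/t !in_itv /= ?andbT.
  by case: ltP => ut ?; [left|right].
by case: ltP => ut [[]|[]].
Qed.

Hypothesis C_supermod : forall x x' y y', x <= x' -> y <= y' ->
  C x y' + C x' y <= C x y + C x' y'.

Lemma volume_ge0 a b c d : a <= b -> c <= d -> 0 <= volume a b c d.
Proof. by move=> ab cd; rewrite /volume; have := C_supermod ab cd; lra. Qed.

Definition hits (P : cell -> Prop) n Q := [set u |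
  cell_start Q <= u < cell_start Q + cell_mass Q /\ P (iter n (cell_step u) Q)].

Lemma measurable_hits P n Q : measurable (hits P n Q).
Proof.
have -> : hits P n Q = `[cell_start Q, cell_start Q + cell_mass Q[ `&`
    [set u | P (iter n (cell_step u) Q)].
  by apply/seteqP; split => u; rewrite /hits /= in_itv.
by apply: measurableI; [exact: measurable_itv|exact: measurable_cell_iter].
Qed.

Lemma hitsS P n Q : cell_valid Q ->
  lebesgue_measure (hits P n.+1 Q) =
  (lebesgue_measure (hits P n (cell_low Q)) +
   lebesgue_measure (hits P n (cell_high Q)))%E.
Proof.
move=> vQ.
have [[l1 l2] _] := cell_low_valid vQ; have [[h1 h2] _] := cell_high_valid vQ.
have l0 := volume_ge0 l1 l2; have h0 := volume_ge0 h1 h2.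
rewrite -/(cell_mass (cell_low Q)) in l0; rewrite -/(cell_mass (cell_high Q)) in h0.
have El : cell_start (cell_low Q) = cell_start Q by case: (Q) => ? ? ? ? ? [].
have Eh : cell_start (cell_high Q) = cell_start Q + cell_mass (cell_low Q).
  by case: (Q) => ? ? ? ? ? [].
rewrite -measureU; [|exact: measurable_hits|exact: measurable_hits|].
  congr (lebesgue_measure _); apply/seteqP; split => u;
    rewrite /hits /setU /mkset ?El ?Eh ?iterSr ?(cell_mass_split Q) /cell_step.
    move=> [/andP[u1 u2]]; case: ltP => ut Pu; [left|right].
      by rewrite u1 ?ut.
    by rewrite ?ut -addrA.
  move=> [[/andP[u1 u2] Pu]|[/andP[u1 u2] Pu]].
    by rewrite u1 u2; split => //; lra.
  by rewrite [u < _ + cell_mass (cell_low Q)]ltNge u1 /=; split => //; lra.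
apply/seteqP; split => // u [[/andP[_ u1] _] [/andP[+ _] _]].
by rewrite El Eh in u1 *; lra.
Qed.

(** The two sides split additively along the tree, and the inequality is trivial
at the leaves. *)
Lemma hits_le P x y n Q : cell_valid Q ->
  (forall Q', cell_valid Q' -> P Q' -> cell_mass Q' <= part_mass x y Q') ->
  (lebesgue_measure (hits P n Q) <= (part_mass x y Q)%:E)%E.
Proof.
move=> + PQ; elim: n Q => [|n IH] Q vQ; last first.
  rewrite hitsS // part_mass_split EFinD; apply: leeD; apply: IH.
    by have [] := cell_low_valid vQ.
  by have [] := cell_high_valid vQ.
have [v1 v2] := vQ.
have V0 : 0 <= cell_mass Q by exact: volume_ge0.
have W0 : 0 <= part_mass x y Q.
  by apply: volume_ge0; rewrite le_min !ge_min ?v1 ?v2 lexx orbT.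
have [PQ0|PQ0] := pselect (P Q); last first.
  by rewrite (_ : hits _ _ _ = set0) ?measure0 ?lee_fin //; apply/seteqP; split => // u [].
rewrite (_ : hits _ _ _ = `[cell_start Q, cell_start Q + cell_mass Q[%classic); last first.
  by apply/seteqP; split => u; rewrite /hits /= in_itv //= => -[].
rewrite lebesgue_measure_itv /= lte_fin; case: ifP => _; last by rewrite lee_fin.
by rewrite -EFinB lee_fin addrAC subrr add0r; exact: PQ.
Qed.

Lemma hits_ge P x y n Q : cell_valid Q ->
  (forall Q', cell_valid Q' -> part_mass x y Q' <= cell_mass Q') ->
  (forall Q', cell_valid Q' -> ~ P Q' -> part_mass x y Q' <= 0) ->
  ((part_mass x y Q)%:E <= lebesgue_measure (hits P n Q))%E.
Proof.
move=> + le_mass PQ; elim: n Q => [|n IH] Q vQ; last first.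
  rewrite hitsS // part_mass_split EFinD; apply: leeD; apply: IH.
    by have [] := cell_low_valid vQ.
  by have [] := cell_high_valid vQ.
have [v1 v2] := vQ.
have V0 : 0 <= cell_mass Q by exact: volume_ge0.
have [PQ0|PQ0] := pselect (P Q); last first.
  by apply: le_trans (measure_ge0 _ _); rewrite lee_fin; exact: PQ.
rewrite (_ : hits _ _ _ = `[cell_start Q, cell_start Q + cell_mass Q[%classic); last first.
  by apply/seteqP; split => u; rewrite /hits /= in_itv //= => -[].
rewrite lebesgue_measure_itv /= lte_fin; case: ltP => h.
  by rewrite -EFinB lee_fin addrAC subrr add0r; exact: le_mass.
by rewrite lee_fin; apply: le_trans (le_mass _ vQ) _; lra.
Qed.


Hypothesis C_left : forall y, 0 <= y <= 1 -> C 0 y = 0.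
Hypothesis C_bottom : forall x, 0 <= x <= 1 -> C x 0 = 0.
Hypothesis C_top : forall x, 0 <= x <= 1 -> C x 1 = x.
Hypothesis C_right : forall y, 0 <= y <= 1 -> C 1 y = y.

Lemma copula_lipschitz x x' y y' : 0 <= x -> x <= x' -> x' <= 1 ->
  0 <= y -> y <= y' -> y' <= 1 -> C x' y' <= C x y + (x' - x) + (y' - y).
Proof.
move=> x0 xx' x'1 y0 yy' y'1.
have := C_supermod xx' y'1; have := C_supermod (le_trans xx' x'1) yy'.
have -> : C x 1 = x by apply: C_top; lra.
have -> : C x' 1 = x' by apply: C_top; lra.
have -> : C 1 y = y by apply: C_right; lra.
have -> : C 1 y' = y' by apply: C_right; lra.
by lra.
Qed.

Lemma root_mass : cell_mass (Cell 0 1 0 1 0 true) = 1.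
Proof.
rewrite /cell_mass /volume /= !C_top ?C_right ?C_left; lra.
Qed.

Lemma part_mass_root x y : 0 <= x <= 1 -> 0 <= y <= 1 ->
  part_mass x y (Cell 0 1 0 1 0 true) = C x y.
Proof.
move=> /andP[x0 x1] /andP[y0 y1]; rewrite /part_mass /volume /=.
rewrite (min_l x0) (min_r x1) (min_l y0) (min_r y1).
by rewrite !C_left ?C_bottom ?x0 ?y0 ?lexx ?ler01 //; lra.
Qed.

Lemma hits_root P n :
  hits P n (Cell 0 1 0 1 0 true) = [set u | 0 <= u < 1 /\ P (cell_at u n)].
Proof. by rewrite /hits root_mass /= add0r. Qed.

Lemma measurable_limit_x : measurable_fun setT limit_x.
Proof.
have -> : limit_x = fun u => sups (fun n => cell_a (cell_at u n)) 0%N.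
  apply/funext => u; rewrite /sups /limit_x; congr sup.
  by apply/seteqP; split => _ [n _ <-]; exists n.
apply: measurable_realfun.measurable_fun_sups.
  move=> u _; exists (cell_b (cell_at u 0)) => _ [m _ <-].
  by have [] := cell_at_sub u (leq0n m); have [] := cell_at_valid u m; lra.
move=> n _ A mA; rewrite setTI.
exact: (measurable_cell_iter (fun Q => A (cell_a Q))).
Qed.

Lemma measurable_limit_y : measurable_fun setT limit_y.
Proof.
have -> : limit_y = fun u => sups (fun n => cell_c (cell_at u n)) 0%N.
  apply/funext => u; rewrite /sups /limit_y; congr sup.
  by apply/seteqP; split => _ [n _ <-]; exists n.
apply: measurable_realfun.measurable_fun_sups.
  move=> u _; exists (cell_d (cell_at u 0)) => _ [m _ <-].
  by have [] := cell_at_sub u (leq0n m); have [] := cell_at_valid u m; lra.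
move=> n _ A mA; rewrite setTI.
exact: (measurable_cell_iter (fun Q => A (cell_c Q))).
Qed.

Definition limit_set x y : set R :=
  [set u | 0 <= u < 1 /\ (limit_x u <= x /\ limit_y u <= y)].

Lemma measurable_limit_set x y : measurable (limit_set x y).
Proof.
have -> : limit_set x y =
    `[0, 1[ `&` ((limit_x @^-1` `]-oo, x]) `&` (limit_y @^-1` `]-oo, y])).
  by apply/seteqP; split => u; rewrite /limit_set /= !in_itv.
apply: measurableI; first exact: measurable_itv.
apply: measurableI; rewrite -[X in measurable X]setTI.
  by apply: measurable_limit_x => //; exact: measurable_itv.
by apply: measurable_limit_y => //; exact: measurable_itv.
Qed.

Lemma volume_min1 a b c d x : a <= b -> c <= d ->
  volume (Num.min a x) (Num.min b x) c d <= volume a b c d.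
Proof.
move=> ab cd; case: (leP a x) => ax; case: (leP b x) => bx //; last first.
- by apply: le_trans (volume_ge0 ab cd); rewrite /volume; lra.
- by apply: le_trans (volume_ge0 ab cd); rewrite /volume; lra.
- by have := volume_ge0 (ltW bx) cd; rewrite /volume; lra.
Qed.

Lemma volume_min2 a b c d y : a <= b -> c <= d ->
  volume a b (Num.min c y) (Num.min d y) <= volume a b c d.
Proof.
move=> ab cd; case: (leP c y) => cy; case: (leP d y) => dy //; last first.
- by apply: le_trans (volume_ge0 ab cd); rewrite /volume; lra.
- by apply: le_trans (volume_ge0 ab cd); rewrite /volume; lra.
- by have := volume_ge0 ab (ltW dy); rewrite /volume; lra.
Qed.

Lemma part_mass_le x y Q : cell_valid Q -> part_mass x y Q <= cell_mass Q.
Proof.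
move=> [v1 v2]; apply: (le_trans (volume_min1 _ _ _)) => //.
  by rewrite le_min !ge_min v2 lexx orbT.
exact: volume_min2.
Qed.

(** The sets of parameters whose cell of depth 2 n is contained in, respectively
has its lower left corner in, a quadrant enclose the set of parameters whose
limit point lies in that quadrant, up to a shift of 2^-n. *)
Lemma limit_law x y : 0 <= x <= 1 -> 0 <= y <= 1 ->
  lebesgue_measure (limit_set x y) = (C x y)%:E.
Proof.
move=> x01 y01.
have vroot : cell_valid (Cell 0 1 0 1 0 true) by split => /=; lra.
apply: le_anti; apply/andP; split; apply/lee_addgt0Pr => e e0.
  have [|n ne] := @exists_half_exp R (e / 2); first by lra.
  pose x' := Num.min 1 (x + e / 2); pose y' := Num.min 1 (y + e / 2).
  have [x'1 x'e xx'] : [/\ x' <= 1, x' <= x + e / 2 & x <= x'].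
    by rewrite /x' le_min !ge_min !lexx orbT; split => //; lra.
  have [y'1 y'e yy'] : [/\ y' <= 1, y' <= y + e / 2 & y <= y'].
    by rewrite /y' le_min !ge_min !lexx orbT; split => //; lra.
  pose P Q := cell_b Q <= x' /\ cell_d Q <= y'.
  apply: (@le_trans _ _ (lebesgue_measure (hits P n.*2 (Cell 0 1 0 1 0 true)))).
    apply: le_measure; rewrite ?inE; [exact: measurable_limit_set|exact: measurable_hits|].
    rewrite hits_root => u [u01 [Xx Yy]]; split => //.
    have [wx wy _] := cell_at_width u n.
    have [/andP[X1 X2] /andP[Y1 Y2]] := cell_at_limit u n.*2.
    have [/= _ b1 _ d1] := cell_at_sub u (leq0n n.*2).
    by split; rewrite le_min; lra.
  apply: (@le_trans _ _ (part_mass x' y' (Cell 0 1 0 1 0 true))%:E).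
    apply: hits_le => // Q [v1 v2] [bx dy]; rewrite /part_mass /cell_mass.
    by rewrite !min_l //; lra.
  rewrite part_mass_root -?EFinD ?lee_fin; [|lra..].
  by have := @copula_lipschitz x x' y y'; lra.
have Cx : C x y <= x by have := @copula_lipschitz 0 x y y; rewrite C_left //; lra.
have Cy : C x y <= y by have := @copula_lipschitz x x 0 y; rewrite C_bottom //; lra.
have [xe|xe] := leP (x - e / 2) 0.
  by apply: le_trans (leeDr _ (measure_ge0 _ _)); rewrite lee_fin; lra.
have [ye|ye] := leP (y - e / 2) 0.
  by apply: le_trans (leeDr _ (measure_ge0 _ _)); rewrite lee_fin; lra.
have [|n ne] := @exists_half_exp R (e / 2); first by lra.
pose x' := x - e / 2; pose y' := y - e / 2.
have x'E : x' = x - e / 2 by []. have y'E : y' = y - e / 2 by [].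
pose P Q := cell_a Q <= x' /\ cell_c Q <= y'.
apply: (@le_trans _ _ (C x' y' + e)%:E).
  by rewrite lee_fin; have := @copula_lipschitz x' x y' y; lra.
rewrite EFinD leeD2r //.
apply: (@le_trans _ _ (lebesgue_measure (hits P n.*2 (Cell 0 1 0 1 0 true)))).
  rewrite -part_mass_root; [|lra..].
  apply: hits_ge => //; first by move=> Q; exact: part_mass_le.
  move=> Q [v1 v2] /not_andP[/negP|/negP]; rewrite -ltNge => lt; rewrite /part_mass.
    by rewrite (min_r (ltW lt)) (min_r (le_trans (ltW lt) v1)) /volume; lra.
  by rewrite (min_r (ltW lt)) (min_r (le_trans (ltW lt) v2)) /volume; lra.
apply: le_measure; rewrite ?inE; [exact: measurable_hits|exact: measurable_limit_set|].
rewrite hits_root => u [u01 [Xx Yy]]; split => //.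
have [wx wy _] := cell_at_width u n; have [/andP[X1 X2] /andP[Y1 Y2]] := cell_at_limit u n.*2.
by split; lra.
Qed.

End Copula.

Section Trim.
Context d (T : measurableType d) (R : realType).
Variables (m : {measure set T -> \bar R}) (m1 : m setT = 1%E).

(** A measure with its values on non-measurable sets reset to 0, as [permuton]
requires. The proof that the total mass is 1 is an argument so that the
probability structure can be inferred. *)
Definition trim (h : m setT = 1%E) (A : set T) : \bar R :=
  if `[< measurable A >] then m A else 0%E.

Lemma trimE A : measurable A -> trim m1 A = m A.
Proof. by move=> mA; rewrite /trim asboolT. Qed.

Lemma trim_junk A : ~ measurable A -> trim m1 A = 0%E.
Proof. by move=> mA; rewrite /trim asboolF. Qed.

Let trim0 : trim m1 set0 = 0%E. Proof. by rewrite trimE ?measure0. Qed.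

Let trim_ge0 A : (0 <= trim m1 A)%E.
Proof. by rewrite /trim; case: ifP. Qed.

Let trim_sigma_additive : semi_sigma_additive (trim m1).
Proof.
move=> F mF tF mUF; rewrite trimE //.
rewrite (_ : (fun n => _) = (fun n => \sum_(0 <= i < n) m (F i))%E).
  exact: measure_semi_sigma_additive.
by apply/funext => n; apply: eq_bigr => i _; rewrite trimE.
Qed.

HB.instance Definition _ := isMeasure.Build d T R (trim m1)
  trim0 trim_ge0 trim_sigma_additive.

Let trim_setT : trim m1 setT = 1%E. Proof. by rewrite trimE. Qed.

HB.instance Definition _ := Measure_isProbability.Build d T R (trim m1) trim_setT.

End Trim.

Section CopulaPermuton.
Context (R : realType) (C : R -> R -> R).
Hypothesis C_supermod : forall x x' y y', x <= x' -> y <= y' ->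
  C x y' + C x' y <= C x y + C x' y'.
Hypothesis C_left : forall y, 0 <= y <= 1 -> C 0 y = 0.
Hypothesis C_bottom : forall x, 0 <= x <= 1 -> C x 0 = 0.
Hypothesis C_top : forall x, 0 <= x <= 1 -> C x 1 = x.
Hypothesis C_right : forall y, 0 <= y <= 1 -> C 1 y = y.

Lemma limit_xy_01 u : 0 <= limit_x C u <= 1 /\ 0 <= limit_y C u <= 1.
Proof. exact: (cell_at_limit C u 0). Qed.

Lemma lebesgue_unit_itv : lebesgue_measure (`[0, 1[%classic : set R) = 1%E.
Proof. by rewrite lebesgue_measure_itv /= lte_fin ltr01 sube0. Qed.

(** The image of the Lebesgue measure on [0, 1[ by the limit point of the nested
cells. Its marginals are uniform because C x 1 = x and C 1 y = y. *)
Lemma copula_permuton : exists mu : permuton R,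
  forall x y, 0 <= x <= 1 -> 0 <= y <= 1 -> joint_cdf mu x y = C x y.
Proof.
pose T u := (limit_x C u, limit_y C u).
have mx := measurable_limit_x C; have my := measurable_limit_y C.
have mT : measurable_fun setT T by exact: measurable_fun_pair.
have mI : measurable (`[0, 1[%classic : set R) by exact: measurable_itv.
pose idR : measurableTypeR R -> R := idfun.
have midR : measurable_fun setT idR by move=> _ A mA; rewrite setTI.
pose push_id : {measure set R -> \bar R} := pushforward lebesgue_measure idR.
have [lam lamE] : exists lam : {measure set R -> \bar R},
    forall A, lam A = lebesgue_measure A.
  by exists (push_id midR).
pose L : {measure set R -> \bar R} := mrestr lam mI.
have LE A : L A = lebesgue_measure (A `&` `[0, 1[) by rewrite -lamE.
pose push_T : {measure set (R * R) -> \bar R} := pushforward L T.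
have [m mE] : exists m : {measure set (R * R) -> \bar R},
    forall A, m A = lebesgue_measure (T @^-1` A `&` `[0, 1[).
  by exists (push_T mT) => // A; rewrite -lamE.
have m1 : m setT = 1%E by rewrite mE preimage_setT setTI lebesgue_unit_itv.
have mquad x y : 0 <= x <= 1 -> 0 <= y <= 1 ->
    m (`]-oo, x] `*` `]-oo, y]) = (C x y)%:E.
  move=> x01 y01; rewrite mE -limit_law //; congr (lebesgue_measure _).
  apply/seteqP; split => u; rewrite /limit_set /= !in_itv /=; tauto.
have marg (g : R -> R) : measurable_fun setT g -> (forall u, 0 <= g u <= 1) ->
    (forall x, 0 <= x <= 1 -> L (g @^-1` `]-oo, x]) = x%:E) ->
    forall A, measurable A -> L (g @^-1` A) = lebesgue_measure (A `&` @unit_interval R).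
  move=> mg g01 gE A mA.
  have mU : measurable (@unit_interval R) by exact: measurable_itv.
  rewrite -lamE; apply: (@finite_measure_lower_unique _ (pushforward L g)
     (mrestr lam mU)) => //.
    rewrite -[X in (X < _)%E]/(L (g @^-1` setT)) preimage_setT LE setTI.
    by rewrite lebesgue_unit_itv ltry.
  move=> x; rewrite -[LHS]/(L (g @^-1` `]-oo, x])).
  rewrite -[RHS]/(lam (`]-oo, x] `&` @unit_interval R)) lamE.
  have [x0|x0] := ltP x 0.
    rewrite (_ : g @^-1` _ = set0) ?measure0; last first.
      by apply/seteqP; split => // u /=; rewrite in_itv /=; have := g01 u; lra.
    rewrite (_ : _ `&` _ = set0) ?measure0 //.
    by apply/seteqP; split => // u /=; rewrite /unit_interval /= !in_itv /=; lra.
  have [x1|x1] := leP x 1.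
    by rewrite gE ?lebesgue_lower ?x0.
  rewrite (_ : g @^-1` _ = g @^-1` `]-oo, 1]); last first.
    by apply/seteqP; split => u /=; rewrite !in_itv /=; have := g01 u; lra.
  rewrite gE ?ler01 ?lexx // -[LHS](@lebesgue_lower R 1) ?ler01 ?lexx //.
  congr (lebesgue_measure _).
  by apply/seteqP; split => u /=; rewrite /unit_interval /= !in_itv /=; lra.
have marg1 A : measurable A ->
    trim m1 (A `*` setT) = lebesgue_measure (A `&` @unit_interval R).
  move=> mA; rewrite trimE; last exact: measurableX.
  rewrite -(marg (limit_x C)) // => [|u|x x01].
  - rewrite mE LE; congr (lebesgue_measure _).
    by apply/seteqP; split => u /=; tauto.
  - by have [] := limit_xy_01 u.
  - rewrite -[in RHS](C_top x01) -mquad ?ler01 ?lexx // mE LE; congr (lebesgue_measure _).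
    apply/seteqP; split => u /=; rewrite !in_itv /=; first last.
      by tauto.
    by have [_ /andP[_ y1]] := limit_xy_01 u => -[ux uI]; split.
have marg2 A : measurable A ->
    trim m1 (setT `*` A) = lebesgue_measure (A `&` @unit_interval R).
  move=> mA; rewrite trimE; last exact: measurableX.
  rewrite -(marg (limit_y C)) // => [|u|x x01].
  - rewrite mE LE; congr (lebesgue_measure _).
    by apply/seteqP; split => u /=; tauto.
  - by have [] := limit_xy_01 u.
  - rewrite -[in RHS](C_right x01) -mquad ?ler01 ?lexx // mE LE; congr (lebesgue_measure _).
    apply/seteqP; split => u /=; rewrite !in_itv /=; first last.
      by tauto.
    by have [/andP[_ x1] _] := limit_xy_01 u => -[uy uI]; split.
exists (@Permuton R (trim m1) marg1 marg2 (@trim_junk _ _ _ _ m1)) => x y x01 y01.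
rewrite /joint_cdf /mass /= trimE; last exact: measurable_quadrant.
by rewrite mquad.
Qed.

End CopulaPermuton.

Section Inverse.
Context (R : realType).

Lemma excursion_permuton (phi : @unit_interval R -> R) : excursion_function phi ->
  exists2 mu : permuton R, Av231 mu &
  forall x y, 0 <= x <= 1 -> 0 <= y <= 1 -> joint_cdf mu x y = stack_cdf phi x y.
Proof.
move=> ephi; have [|||||mu muE] := @copula_permuton R (stack_cdf phi).
- exact: stack_cdf_supermod.
- exact: stack_cdf_left.
- exact: stack_cdf_bottom.
- exact: stack_cdf_top.
- exact: stack_cdf_right.
by exists mu => //; exact: stack_cdf_Av231 ephi muE.
Qed.

End Inverse.

(** * Integrals of test functions *)

Section TestFunctions.
Context (R : realType).
Local Notation K := (@unit_square R).

Lemma unit_squareP (p : R * R) : K p <-> 0 <= p.1 <= 1 /\ 0 <= p.2 <= 1.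
Proof. by rewrite /unit_square /unit_interval /= !in_itv. Qed.

Lemma measurable_unit_square : measurable K.
Proof. by apply: measurableX; exact: measurable_itv. Qed.

Lemma compact_unit_square : compact K.
Proof. by apply: compact_setX; exact: segment_compact. Qed.

Lemma test_function_unif_continuous (g : test_function R) (e : R) : 0 < e ->
  exists2 r, 0 < r & forall p q, K p -> K q ->
    `|p.1 - q.1| < r -> `|p.2 - q.2| < r -> `|val g p - val g q| < e.
Proof.
move=> e0; have cg : {within K, continuous (val g)} := set_valP g.
pose P (r : R) (p : R * R) := forall q, K q ->
  `|p.1 - q.1| < r -> `|p.2 - q.2| < r -> `|val g p - val g q| < e.
have : \forall r \near 0^'+, K `<=` P r.
  have /compact_near_coveringP/near_covering_withinP := compact_unit_square.
  apply => p Kp.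
  have /subspace_continuousP/(_ p Kp)/cvgrPdist_lt/(_ (e / 2)) := cg.
  have e2 : 0 < e / 2 by lra.
  move=> /(_ e2)/nbhs_ballP[d /= d0 dP].
  have d2 : 0 < d / 2 by lra.
  exists (ball p (d / 2), [set r | r < d / 2]).
    by split => /=; [exact: nbhsx_ballx|exact: nbhs_right_lt].
  move=> [p' r] /= [[b1 b2] rd] Kp' q Kq q1 q2.
  have h1 : `|val g p - val g p'| < e / 2.
    apply: dP => //; split; [move: b1|move: b2]; rewrite /ball /=; lra.
  have h2 : `|val g p - val g q| < e / 2.
    apply: dP => //; split; rewrite /ball /=.
      rewrite -(subrKA p'.1) (le_lt_trans (ler_normD _ _)) //.
      by move: b1; rewrite /ball /=; lra.
    rewrite -(subrKA p'.2) (le_lt_trans (ler_normD _ _)) //.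
    by move: b2; rewrite /ball /=; lra.
  rewrite -(subrKA (val g p)) (le_lt_trans (ler_normD _ _)) //.
  by rewrite (distrC _ (val g p)); lra.
move=> near_P; near (0 : R)^'+ => r; exists r => //.
move=> p q Kp; have : K `<=` P r by near: r.
exact.
Unshelve. all: by end_near. Qed.

Lemma test_function_bounded (g : test_function R) :
  exists2 M, 0 <= M & forall p, K p -> `|val g p| <= M.
Proof.
have cg : {within K, continuous (val g)} := set_valP g.
have /compact_bounded[M [_ hM]] := continuous_compact cg compact_unit_square.
exists (`|M| + 1); first by have := normr_ge0 M; lra.
move=> p Kp; apply: hM; last by exists p.
by have := ler_norm M; lra.
Qed.

Definition rat_rect (n : nat) : set (R * R) :=
  if @unpickle (rat * rat * rat * rat)%type n is Some (a, b, c, d)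
  then `]ratr a, ratr b[ `*` `]ratr c, ratr d[ else set0.

(** The set where the function exceeds y is, in the square, the union of the
rational open rectangles on which it does. *)
Lemma measurable_test_function (g : test_function R) : measurable_fun K (val g).
Proof.
move=> mK; apply: (measurability _ (measurable_realfun.RGenOInfty.measurableE R)) => //.
move=> _ [_ [y ->] <-].
rewrite (_ : _ `&` _ = \bigcup_(n in [set n | K `&` rat_rect n `<=`
    K `&` val g @^-1` `]y, +oo[]) (K `&` rat_rect n)).
  apply: bigcup_measurable => n _; apply: measurableI => //.
  by rewrite /rat_rect; case: unpickle => [[[[a b] c] d]|//]; exact: measurableX.
apply/seteqP; split; last by move=> p [n nP np]; exact: nP.
move=> p [Kp gp].
have gpy : 0 < val g p - y by move: gp; rewrite /= in_itv /= andbT; lra.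
(* Rational rectangle of half-side at most r / 2 around p. *)
have [r r0 rP] := test_function_unif_continuous g gpy.
have lt1 (u : R) : u - r / 2 < u by lra.
have lt2 (u : R) : u < u + r / 2 by lra.
have [a] := rat_in_itvoo (lt1 p.1); rewrite in_itv /= => /andP[a1 a2].
have [b] := rat_in_itvoo (lt2 p.1); rewrite in_itv /= => /andP[b1 b2].
have [c] := rat_in_itvoo (lt1 p.2); rewrite in_itv /= => /andP[c1 c2].
have [d] := rat_in_itvoo (lt2 p.2); rewrite in_itv /= => /andP[d1 d2].
exists (pickle (a, b, c, d)); rewrite /mkset /rat_rect pickleK; last first.
  by split => //=; rewrite !in_itv /= a2 b1 c2 d1.
move=> q [Kq]; rewrite /= !in_itv /= => -[/andP[q1 q2] /andP[q3 q4]].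
have p1 : `|p.1 - q.1| < r by rewrite ltr_norml; lra.
have p2 : `|p.2 - q.2| < r by rewrite ltr_norml; lra.
have := rP p q Kp Kq p1 p2; rewrite ltr_norml => /andP[_ gq].
by split => //; rewrite andbT; move: gq; rewrite ltrBlDr -ltrBlDl opprB addrC subrK.
Qed.

Lemma integrable_test_function (mu : permuton R) (g : test_function R) S :
  measurable S -> S `<=` K -> mu.-integrable S (EFin \o val g).
Proof.
move=> mS SK; apply: (integrableS measurable_unit_square mS SK).
apply: measurable_bounded_integrable.
- exact: measurable_unit_square.
- by rewrite -ge0_fin_numE // fin_num_measure //; exact: measurable_unit_square.
- exact: measurable_test_function.
- have [M M0 hM] := test_function_bounded g.
  exists M; split; first exact: num_real.
  by move=> x Mx p /= Kp; apply: le_trans (hM p Kp) (ltW Mx).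
Qed.

Definition test_integral (mu : permuton R) (g : test_function R) S : R :=
  \int[mu]_(x in S) val g x.

Lemma integrable_cst (mu : permuton R) S (c : R) : measurable S ->
  mu.-integrable S (EFin \o cst c).
Proof.
move=> mS; apply: measurable_bounded_integrable => //.
  by rewrite -ge0_fin_numE // fin_num_measure.
by exists `|c|; split; [exact: num_real|move=> x cx p _ /=; exact: ltW].
Qed.

Lemma test_integral_le mu g S (c : R) : measurable S -> S `<=` K ->
  (forall p, S p -> val g p <= c) -> test_integral mu g S <= c * mass mu S.
Proof.
move=> mS SK h; rewrite /mass -Rintegral_cst //.
by apply: le_Rintegral => //; [exact: integrable_test_function|exact: integrable_cst].
Qed.

Lemma test_integral_ge mu g S (c : R) : measurable S -> S `<=` K ->
  (forall p, S p -> c <= val g p) -> c * mass mu S <= test_integral mu g S.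
Proof.
move=> mS SK h; rewrite /mass -Rintegral_cst //.
by apply: le_Rintegral => //; [exact: integrable_cst|exact: integrable_test_function].
Qed.

Lemma test_integralU mu g S T V : measurable S -> measurable T -> V `<=` K ->
  (forall p, V p <-> S p \/ T p) -> (forall p, S p -> ~ T p) ->
  test_integral mu g V = test_integral mu g S + test_integral mu g T.
Proof.
move=> mS mT VK VST ST.
have VE : V = S `|` T by apply/seteqP; split => p /VST.
rewrite /test_integral VE Rintegral_setU //.
  by apply: integrable_test_function; [exact: measurableU|rewrite -VE].
by apply/disj_setPS => p [/ST].
Qed.

End TestFunctions.

(** * Uniform closeness of distribution functions implies weak closeness *)

Section WeakConvergence.
Context (R : realType).
Local Notation K := (@unit_square R).
Implicit Types (mu nu : permuton R) (g : test_function R).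

Definition cdf_close mu nu (dl : R) := forall x y,
  0 <= x <= 1 -> 0 <= y <= 1 -> `|joint_cdf mu x y - joint_cdf nu x y| <= dl.

Local Notation rect a b c d := (`]a, b] `*` `]c, d] : set (R * R)).

Lemma measurable_rect (a b c d : R) : measurable (rect a b c d).
Proof. by apply: measurableX; exact: measurable_itv. Qed.

Lemma rect_sub_unit (a b c d : R) : 0 <= a -> b <= 1 -> 0 <= c -> d <= 1 ->
  rect a b c d `<=` K.
Proof.
move=> a0 b1 c0 d1 p [/=]; rewrite !in_itv /= => /andP[? ?] /andP[? ?].
by apply/unit_squareP; lra.
Qed.

(** The integrals over a rectangle against two permutons differ by a small multiple
of its masses and a constant times the distance of the distribution functions.
Unlike a bound with fixed constants, this is stable under cutting the rectangle,
which replaces Riemann sums by an induction on halvings. *)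
Definition integral_controlled g (e a b c d : R) := exists M, forall mu nu dl,
  cdf_close mu nu dl ->
  `|test_integral mu g (rect a b c d) - test_integral nu g (rect a b c d)| <=
  e * (mass mu (rect a b c d) + mass nu (rect a b c d)) + M * dl.

Lemma integral_controlled_small g (e a b c d : R) :
  0 <= a -> a <= b -> b <= 1 -> 0 <= c -> c <= d -> d <= 1 ->
  (forall p, rect a b c d p -> `|val g p - val g (b, d)| <= e) ->
  integral_controlled g e a b c d.
Proof.
move=> a0 ab b1 c0 cd d1 osc; exists (4 * `|val g (b, d)|) => mu nu dl close.
move: osc; set Q := rect a b c d; move: (val g (b, d)) => z osc.
have mQ := measurable_rect a b c d; have QK := rect_sub_unit a0 b1 c0 d1.
have bounds (m : permuton R) : (z - e) * mass m Q <= test_integral m g Q /\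
    test_integral m g Q <= (z + e) * mass m Q.
  split; [apply: test_integral_ge => // p Qp|apply: test_integral_le => // p Qp];
    by have := osc p Qp; rewrite ler_norml => /andP[]; lra.
have [l1 u1] := bounds mu; have [l2 u2] := bounds nu.
have mm : `|mass mu Q - mass nu Q| <= 4 * dl.
  rewrite !mass_rect // ler_norml.
  have := close b d; have := close a d; have := close b c; have := close a c.
  rewrite !ler_norml; lra.
have : `|z * (mass mu Q - mass nu Q)| <= 4 * `|z| * dl.
  by rewrite normrM mulrAC [4 * dl * _]mulrC ler_wpM2l.
rewrite !ler_norml; move: l1 u1 l2 u2; rewrite -/Q.
move: (mass mu Q) (mass nu Q) (test_integral mu g Q) (test_integral nu g Q).
move: (`|z|) => w m n i j.
rewrite !mulrBl !mulrDl !mulrDr !mulrN => l1 u1 l2 u2 /andP[k1 k2].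
by apply/andP; split; lra.
Qed.

Lemma integral_controlled_split1 g (e a m b c d : R) : 0 <= a -> a <= m -> m <= b -> b <= 1 ->
  0 <= c -> d <= 1 ->
  integral_controlled g e a m c d -> integral_controlled g e m b c d ->
  integral_controlled g e a b c d.
Proof.
move=> a0 am mb b1 c0 d1 [M1 h1] [M2 h2]; exists (M1 + M2) => mu nu dl close.
have split1 (p : R * R) : rect a b c d p <-> rect a m c d p \/ rect m b c d p.
  case: p => u v /=; rewrite !in_itv /=; split; last first.
    by move=> [] [/andP[? ?] ->]; split => //; lra.
  by move=> [/andP[au ub] ->]; case: (leP u m) => um; [left|right]; split => //; lra.
have split2 (p : R * R) : rect a m c d p -> ~ rect m b c d p.
  by case: p => u v /=; rewrite !in_itv /= => -[/andP[? ?] _] [/andP[? ?] _]; lra.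
rewrite !(test_integralU _ _ (measurable_rect a m c d) (measurable_rect m b c d)
  (rect_sub_unit a0 b1 c0 d1) split1 split2).
rewrite !(mass_split _ (measurable_rect a m c d) (measurable_rect m b c d) split1 split2).
have := h1 mu nu dl close; have := h2 mu nu dl close.
by rewrite !ler_norml; lra.
Qed.

Lemma integral_controlled_split2 g (e a b c m d : R) : 0 <= a -> b <= 1 ->
  0 <= c -> c <= m -> m <= d -> d <= 1 ->
  integral_controlled g e a b c m -> integral_controlled g e a b m d ->
  integral_controlled g e a b c d.
Proof.
move=> a0 b1 c0 cm md d1 [M1 h1] [M2 h2]; exists (M1 + M2) => mu nu dl close.
have split1 (p : R * R) : rect a b c d p <-> rect a b c m p \/ rect a b m d p.
  case: p => u v /=; rewrite !in_itv /=; split; last first.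
    by move=> [] [-> /andP[? ?]]; split => //; lra.
  by move=> [-> /andP[au ub]]; case: (leP v m) => um; [left|right]; split => //; lra.
have split2 (p : R * R) : rect a b c m p -> ~ rect a b m d p.
  by case: p => u v /=; rewrite !in_itv /= => -[_ /andP[? ?]] [_ /andP[? ?]]; lra.
rewrite !(test_integralU _ _ (measurable_rect a b c m) (measurable_rect a b m d)
  (rect_sub_unit a0 b1 c0 d1) split1 split2).
rewrite !(mass_split _ (measurable_rect a b c m) (measurable_rect a b m d) split1 split2).
have := h1 mu nu dl close; have := h2 mu nu dl close.
by rewrite !ler_norml; lra.
Qed.

Lemma integral_controlled_unit g (e : R) : 0 < e -> integral_controlled g e 0 1 0 1.
Proof.
move=> e0; have [r r0 rP] := test_function_unif_continuous g e0.
have [k kr] := exists_half_exp r0.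
suff h n (s a b c d : R) : 0 <= a -> a <= b -> b <= 1 -> 0 <= c -> c <= d -> d <= 1 ->
    b - a <= s -> d - c <= s -> s * 2^-1 ^+ n < r -> integral_controlled g e a b c d.
  by apply: (h k 1) => //; rewrite ?mul1r ?subr0.
elim: n s a b c d => [|n IH] s a b c d a0 ab b1 c0 cd d1 sab scd.
  rewrite expr0 mulr1 => sr; apply: integral_controlled_small => // -[u v] [/=].
  rewrite !in_itv /= => /andP[? ?] /andP[? ?]; apply: ltW; apply: rP.
  - by apply/unit_squareP => /=; lra.
  - by apply/unit_squareP => /=; lra.
  - by rewrite /= ltr_norml; lra.
  - by rewrite /= ltr_norml; lra.
rewrite exprS mulrA => sr.
have {}IH a' b' c' d' := IH (s * 2^-1) a' b' c' d'.
have half (u v : R) : 0 <= u -> u <= v -> v <= 1 -> v - u <= s -> exists m,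
    [/\ u <= m, m <= v, 0 <= m, m <= 1 & m - u <= s * 2^-1 /\ v - m <= s * 2^-1].
  by move=> *; exists ((u + v) / 2); split; [..|split]; lra.
have [m [am mb m0 m1 [ms sm]]] := half a b a0 ab b1 sab.
have [n' [cn nd n0 n1 [ns sn]]] := half c d c0 cd d1 scd.
by apply: (@integral_controlled_split1 g e a m b) => //;
  apply: (@integral_controlled_split2 g e _ _ c n' d) => //; exact: IH.
Qed.

Lemma test_integral_null mu g S : measurable S -> S `<=` K -> mass mu S = 0 ->
  test_integral mu g S = 0.
Proof.
move=> mS SK S0; have [M M0 hM] := test_function_bounded g.
have := @test_integral_le R mu g S M mS SK; have := @test_integral_ge R mu g S (- M) mS SK.
rewrite S0 !mulr0 => h1 h2; apply: le_anti; apply/andP; split.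
  by apply: h2 => p /SK/hM; rewrite ler_norml => /andP[].
by apply: h1 => p /SK/hM; rewrite ler_norml => /andP[].
Qed.

Lemma mass_unit_rect mu : mass mu (K `\` rect 0 1 0 1) = 0.
Proof.
apply: le_anti; rewrite mass_ge0 andbT.
pose A := `]-oo, 0] `*` setT : set (R * R); pose B := setT `*` `]-oo, 0] : set (R * R).
have mA : measurable A by exact: measurableX.
have mB : measurable B by exact: measurableX.
apply: (@le_trans _ _ (mass mu (A `|` B))).
  apply: le_mass; [|exact: measurableU|].
    by apply: measurableD; [exact: measurable_unit_square|exact: measurable_rect].
  move=> [u v] [/unit_squareP[/= /andP[u0 u1] /andP[v0 v1]] nQ].
  have [u0'|u0'] := leP u 0; first by left; split; rewrite //= in_itv.
  right; split => //=; rewrite in_itv /= leNgt; apply/negP => v0'; apply: nQ.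
  by split; rewrite /= in_itv /= ?u0' ?v0'.
by rewrite (le_trans (mass_subadd _ _ _)) // mass_below1 // mass_below2 // addr0.
Qed.

Lemma permuton_pairing_rect mu g :
  permuton_pairing mu g = test_integral mu g (rect 0 1 0 1).
Proof.
have QK : rect 0 1 0 1 `<=` K by apply: rect_sub_unit.
have mQ := measurable_rect 0 1 0 1.
have mD : measurable (K `\` rect 0 1 0 1).
  by apply: measurableD => //; exact: measurable_unit_square.
rewrite -[LHS]/(test_integral mu g K).
rewrite (@test_integralU _ _ _ (rect 0 1 0 1) (K `\` rect 0 1 0 1)) //.
- by rewrite [X in _ + X]test_integral_null ?addr0 ?mass_unit_rect // => p [].
- move=> p; split=> [Kp|[/QK//|[]//]].
  by have [Qp|nQp] := pselect (rect 0 1 0 1 p); [left|right].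
- by move=> p Qp [_].
Qed.

Lemma permuton_pairing_close g (e : R) : 0 < e -> exists2 dl, 0 < dl &
  forall mu nu, cdf_close mu nu dl ->
    `|permuton_pairing mu g - permuton_pairing nu g| < e.
Proof.
move=> e0; have [|M hM] := @integral_controlled_unit g (e / 4); first by lra.
have M1 : 0 < `|M| + 1 by have := normr_ge0 M; lra.
exists (e / 4 / (`|M| + 1)) => [|mu nu /hM]; first by rewrite divr_gt0 //; lra.
rewrite !permuton_pairing_rect => h; apply: le_lt_trans h _.
have mass1 (m : permuton R) : mass m (rect 0 1 0 1) <= 1.
  rewrite -[leRHS](@mass_lower1 R m 1) ?ler01 ?lexx //.
  apply: le_mass; [exact: measurable_rect|exact: measurableX|].
  by move=> [u v] [/=]; rewrite !in_itv /= => /andP[_ ->].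
have Mle : M * (e / 4 / (`|M| + 1)) <= e / 4.
  have e4 : 0 <= e / 4 by lra.
  rewrite mulrCA ler_piMr // ler_pdivrMr // mul1r.
  by have := ler_norm M; lra.
apply: (@le_lt_trans _ _ (e / 4 * 2 + e / 4)); last by lra.
apply: lerD => //; rewrite ler_wpM2l //; first by lra.
by have := mass1 mu; have := mass1 nu; lra.
Qed.

End WeakConvergence.

(** * Weak closeness implies uniform closeness of distribution functions *)

Section Ramp.
Context (R : realType).
Local Notation K := (@unit_square R).
Implicit Types (mu nu : permuton R) (g : test_function R).
Local Notation rect a b c d := (`]a, b] `*` `]c, d] : set (R * R)).

(** The continuous piecewise linear function equal to 1 up to x and to 0 from
x + dl on, written with absolute values only so that its continuity is
immediate. *)
Definition ramp (dl x u : R) : R :=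
  let z := (x + dl - u) / dl in (`|z| - `|z - 1| + 1) / 2.

Lemma rampP (dl x u : R) : 0 < dl ->
  [/\ 0 <= ramp dl x u <= 1, u <= x -> ramp dl x u = 1 & x + dl <= u -> ramp dl x u = 0].
Proof.
move=> dl0; rewrite /ramp; set z := (x + dl - u) / dl.
have z1 : u <= x -> 1 <= z by move=> ux; rewrite /z ler_pdivlMr //; lra.
have z0 : x + dl <= u -> z <= 0 by move=> ux; rewrite /z ler_pdivrMr //; lra.
move: z z1 z0 => z z1 z0.
split=> [|/z1 {}z1|/z0 {}z0].
- by case: (ger0P z) => ?; case: (ger0P (z - 1)) => ?; lra.
- by rewrite !ger0_norm; lra.
- by rewrite !ler0_norm; lra.
Qed.

Lemma ramp_continuous (dl x : R) : continuous (ramp dl x).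
Proof.
move=> u; rewrite /ramp.
have cz : (x + dl - v) / dl @[v --> u] --> (x + dl - u) / dl.
  by apply: cvgMl; apply: cvgB => //; exact: cvg_cst.
apply: cvgMl; apply: cvgD; last exact: cvg_cst.
apply: cvgB; first exact: cvg_norm.
by apply: cvg_norm; apply: cvgB => //; exact: cvg_cst.
Qed.

(** A product of ramps lies between the indicators of the quadrants at (x, y) and
(x + dl, y + dl), whose masses differ by at most 2 dl for every permuton. *)
Lemma cdf_test_function (x y dl : R) : 0 <= x <= 1 -> 0 <= y <= 1 -> 0 < dl ->
  exists g, forall mu,
    joint_cdf mu x y <= permuton_pairing mu g <= joint_cdf mu x y + 2 * dl.
Proof.
move=> x01 y01 dl0.
pose f (p : R * R) := ramp dl x p.1 * ramp dl y p.2.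
have cf : continuous f.
  move=> p; apply: cvgM.
    by apply: (cvg_comp _ _ cvg_fst); exact: ramp_continuous.
  by apply: (cvg_comp _ _ cvg_snd); exact: ramp_continuous.
have Kf : [set g : R * R -> R | {within K, continuous g}] f.
  exact: continuous_subspaceT.
have [g gE] : exists g : test_function R,
    forall p, val g p = ramp dl x p.1 * ramp dl y p.2.
  by exists (SigSub (mem_set Kf)).
have g01 p : 0 <= val g p <= 1.
  rewrite gE; have [/andP[? ?] _ _] := rampP x p.1 dl0.
  have [/andP[? ?] _ _] := rampP y p.2 dl0.
  by rewrite mulr_ge0 //= mulr_ile1.
exists g => mu; rewrite permuton_pairing_rect.
have mass_corner x' y' : 0 <= x' -> 0 <= y' -> mass mu (rect 0 x' 0 y') = joint_cdf mu x' y'.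
  move=> x'0 y'0; rewrite mass_rect // /joint_cdf.
  rewrite (mass_below1 mu _ (lexx 0)) // !(mass_below2 mu _ (lexx 0)) //.
  by rewrite !subr0.
have split_int x' y' : 0 <= x' <= 1 -> 0 <= y' <= 1 ->
    test_integral mu g (rect 0 1 0 1) = test_integral mu g (rect 0 x' 0 y') +
      test_integral mu g (rect 0 1 0 1 `\` rect 0 x' 0 y').
  move=> x'01 y'01; apply: test_integralU.
  - exact: measurable_rect.
  - by apply: measurableD; exact: measurable_rect.
  - exact: rect_sub_unit.
  - move=> p; split=> [Qp|].
      by have [Sp|nSp] := pselect (rect 0 x' 0 y' p); [left|right].
    move=> [|[]//] [/=]; rewrite !in_itv /= => /andP[? ?] /andP[? ?].
    by split; lra.
  - by move=> p Sp [].
have rest_sub x' y' : rect 0 1 0 1 `\` rect 0 x' 0 y' `<=` K.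
  by move=> p [Qp _]; exact: (rect_sub_unit (lexx 0) (lexx 1) (lexx 0) (lexx 1) Qp).
have mrest x' y' : measurable (rect 0 1 0 1 `\` rect 0 x' 0 y').
  by apply: measurableD; exact: measurable_rect.
apply/andP; split.
  rewrite (split_int x y) //.
  have := @test_integral_ge R mu g _ 0 (mrest x y) (rest_sub x y).
  rewrite mul0r => /(_ (fun p _ => (andP (g01 p)).1)) rest.
  have : joint_cdf mu x y <= test_integral mu g (rect 0 x 0 y); last by lra.
  rewrite -mass_corner; [|lra..]; rewrite -[leLHS]mul1r.
  apply: test_integral_ge; [exact: measurable_rect|by apply: rect_sub_unit; lra|].
  move=> p [/=]; rewrite !in_itv /= => /andP[_ px] /andP[_ py].
  have [_ rx _] := rampP x p.1 dl0; have [_ ry _] := rampP y p.2 dl0.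
  by rewrite gE rx // ry // mulr1.
pose x' := Num.min 1 (x + dl); pose y' := Num.min 1 (y + dl).
have [x'1 x'e xx'] : [/\ x' <= 1, x' <= x + dl & x <= x'].
  by rewrite /x' le_min !ge_min !lexx orbT; split => //; lra.
have [y'1 y'e yy'] : [/\ y' <= 1, y' <= y + dl & y <= y'].
  by rewrite /y' le_min !ge_min !lexx orbT; split => //; lra.
rewrite (split_int x' y'); [|lra..].
have : test_integral mu g (rect 0 x' 0 y') <= joint_cdf mu x' y'.
  rewrite -mass_corner; [|lra..]; rewrite -[leRHS]mul1r.
  apply: test_integral_le; [exact: measurable_rect|by apply: rect_sub_unit; lra|].
  by move=> p _; case/andP: (g01 p).
have : test_integral mu g (rect 0 1 0 1 `\` rect 0 x' 0 y') <= 0.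
  have := @test_integral_le R mu g _ 0 (mrest x' y') (rest_sub x' y').
  rewrite mul0r; apply => p [[/=]]; rewrite !in_itv /= => /andP[p0 p1] /andP[q0 q1] nS.
  have [_ _ rx] := rampP x p.1 dl0; have [_ _ ry] := rampP y p.2 dl0.
  rewrite gE; have [px|px] := leP p.1 x'; last first.
    by rewrite rx ?mul0r //; move: px; rewrite gt_min => /orP[]; lra.
  have [py|py] := leP p.2 y'; last first.
    by rewrite ry ?mulr0 //; move: py; rewrite gt_min => /orP[]; lra.
  by case: nS; rewrite p0 q0 px py.
have := @joint_cdf_incr1 R mu x x' y; have := @joint_cdf_incr2 R mu x' y y'.
lra.
Qed.

End Ramp.

Section Topology.
Context (R : realType).
Implicit Types (mu nu : permuton R) (g : test_function R).

Lemma permuton_pairing_continuous g :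
  continuous (fun mu : permuton R => permuton_pairing mu g : R).
Proof.
move=> mu.
apply: (@continuous_comp _ _ _ (@permuton_pairing R)
  (fun h : {ptws test_function R -> R} => h g)).
  exact: initial_continuous.
exact: proj_continuous.
Qed.

Lemma joint_cdf_near mu (x y e : R) : 0 <= x <= 1 -> 0 <= y <= 1 -> 0 < e ->
  \forall nu \near mu, `|joint_cdf mu x y - joint_cdf nu x y| < e.
Proof.
move=> x01 y01 e0; have [|g gP] := @cdf_test_function R x y (e / 8) x01 y01; first by lra.
have e2 : 0 < e / 2 by lra.
have /cvgrPdist_lt/(_ _ e2) := @permuton_pairing_continuous g mu.
apply: filterS => nu; have := gP mu; have := gP nu.
by rewrite !ltr_norml; lra.
Qed.

(** Distribution functions are 1-Lipschitz in each variable, so that closeness on a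
finite grid, which is a weakly open condition, gives uniform closeness. *)
Lemma cdf_close_near mu (e : R) : 0 < e -> \forall nu \near mu, cdf_close mu nu e.
Proof.
move=> e0; pose N := Num.truncn (8 / e).
have N0 : 0 < N.+1%:R :> R by rewrite ltr0n.
have Ne : N.+1%:R^-1 <= e / 8.
  by rewrite -[e / 8]invrK lef_pV2 ?posrE ?invr_gt0 ?divr_gt0 // invf_div ltW // truncnS_gt.
pose x (i : 'I_N.+2) : R := i%:R / N.+1%:R.
have x01 i : 0 <= x i <= 1.
  by rewrite divr_ge0 //= ler_pdivrMr // mul1r ler_nat -ltnS.
have e4 : 0 < e / 4 by lra.
pose P (ij : 'I_N.+2 * 'I_N.+2) nu :=
  `|joint_cdf mu (x ij.1) (x ij.2) - joint_cdf nu (x ij.1) (x ij.2)| < e / 4.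
have : \forall nu \near mu, forall ij, P ij nu.
  have H ij : nbhs mu (P ij) by apply: joint_cdf_near.
  exact: (@filter_forall _ _ P (nbhs mu) (nbhs_filter mu) H).
move=> grid_near; apply: (filterS _ grid_near) => nu close u v u01 v01.
have grid (w : R) : 0 <= w <= 1 -> exists i, x i <= w /\ w - x i <= e / 8.
  move=> /andP[w0 w1].
  have wN0 : 0 <= w * N.+1%:R by rewrite mulr_ge0 // ltW.
  have /andP[t1 t2] := truncn_itv wN0.
  have tN : (Num.truncn (w * N.+1%:R) < N.+2)%N.
    rewrite ltnS -(ler_nat R); apply: le_trans t1 _.
    by rewrite ler_piMl ?ler0n.
  exists (Ordinal tN); rewrite /x /=; split; first by rewrite ler_pdivrMr.
  apply: le_trans Ne; rewrite lerBlDl -[X in _ + X]mul1r -mulrDl ler_pdivlMr //.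
  by rewrite natr1; exact: ltW.
have [i [iu ui]] := grid u u01; have [j [jv vj]] := grid v v01.
have := close (i, j); rewrite /P /= ltr_norml ler_norml => /andP[c1 c2].
have /andP[i0 i1] := x01 i; have /andP[j0 j1] := x01 j.
have := @joint_cdf_incr1 R mu (x i) u (x j) i0 iu (andP u01).2.
have := @joint_cdf_incr1 R nu (x i) u (x j) i0 iu (andP u01).2.
have := @joint_cdf_incr2 R mu u (x j) v j0 jv (andP v01).2.
have := @joint_cdf_incr2 R nu u (x j) v j0 jv (andP v01).2.
move: c1 c2 ui vj; move: (x i) (x j) => xi xj *.
by apply/andP; split; lra.
Qed.

End Topology.

(** * The correspondence *)

(** Both maps come from choice: the excursion of a permuton exists by
[exists_excursion], the permuton of an excursion by [excursion_permuton]. Since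
a permuton and its excursion share the same distribution function in both cases,
uniqueness of either object given this function makes the maps inverse to each
other, and the two comparison inequalities make them continuous. *)
Theorem proposition2 (R : realType) :
  exists (rlm_excursion : @Av231 R -> @excursions R)
         (rlm_inverse : @excursions R -> @Av231 R),
    [/\ forall mu : @Av231 R,
          is_excursion (rlm_curve (val mu)) (val (rlm_excursion mu)),
        cancel rlm_excursion rlm_inverse,
        cancel rlm_inverse rlm_excursion,
        continuous rlm_excursion &
        continuous rlm_inverse].
Proof.
have exP (phi : @excursions R) : excursion_function (val phi) := set_valP phi.
have ex_fun (mu : @Av231 R) : exists phi : @excursions R,
    is_excursion (rlm_curve (val mu)) (val phi).
  have [phi [ephi isphi]] := exists_excursion (rlm_curve_is_curve (val mu)).
  by exists (SigSub (mem_set (ephi : @excursions R phi))).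
have inv_fun (phi : @excursions R) : exists mu : @Av231 R,
    forall x y, 0 <= x <= 1 -> 0 <= y <= 1 ->
    joint_cdf (val mu) x y = stack_cdf (val phi) x y.
  have [mu avmu muE] := excursion_permuton (exP phi).
  by exists (SigSub (mem_set avmu)).
have [E EP] := choice ex_fun; have [G GP] := choice inv_fun.
have E_cdf (mu : @Av231 R) x y : 0 <= x <= 1 -> 0 <= y <= 1 ->
    joint_cdf (val mu) x y = stack_cdf (val (E mu)) x y.
  by move=> x01 y01; apply: joint_cdf_stack_cdf => //; exact: (set_valP mu).
have dist_E (mu nu : @Av231 R) (e : R) : cdf_close (val mu) (val nu) e ->
    forall t, `|val (E mu) t - val (E nu) t| <= e.
  move=> close; apply: excursion_dist; [exact: exP|exact: exP|].
  by move=> x y x01 y01; rewrite -!E_cdf //; exact: close.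
have dist_G (phi psi : @excursions R) (e : R) :
    (forall t, `|val phi t - val psi t| <= e) ->
    cdf_close (val (G phi)) (val (G psi)) (e *+ 2).
  by move=> close x y x01 y01; rewrite !GP //; exact: stack_cdf_dist.
exists E, G; split.
- exact: EP.
- move=> mu; apply: val_inj; apply: permuton_cdf_eq => x y x01 y01.
  by rewrite GP // E_cdf.
- move=> phi; apply: val_inj; apply/funext => t.
  apply/eqP; rewrite -subr_eq0 -normr_le0.
  apply: excursion_dist; [exact: exP|exact: exP|] => x y x01 y01.
  by rewrite -E_cdf // GP // subrr normr0.
- apply: continuous_comp_initial => mu P /uniform_nbhs[A [entA AP]].
  move: entA; rewrite -entourage_ballE => -[e e0 eA].
  have cval : (val nu : permuton R) @[nu --> mu] --> (val mu : permuton R).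
    exact: initial_continuous.
  have e2 : 0 < e / 2 by rewrite divr_gt0.
  have incl (nu : @Av231 R) :
      cdf_close (val mu) (val nu) (e / 2) -> P (val (E nu)).
    move=> close; apply: AP => t _; apply: eA => /=; rewrite /ball /=.
    apply: le_lt_trans (dist_E mu nu _ close t) _.
    by rewrite ltr_pdivrMr // ltr_pMr // ltr1n.
  exact: (@filterS _ (nbhs mu) (nbhs_filter mu) _ _ incl
    (cval _ (cdf_close_near (val mu) e2))).
- apply: continuous_comp_initial; apply: continuous_comp_initial => phi.
  have Fphi := @fmap_filter _ _ (@permuton_pairing R \o (set_val \o G))
    (nbhs phi) (nbhs_filter phi).
  apply/cvg_sup => g; move: phi {Fphi}; apply: continuous_comp_initial => phi.
  apply/(@cvgrPdist_lt _ _ _ (nbhs phi) (nbhs_filter phi)) => e e0.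
  have [dl dl0 dlP] := permuton_pairing_close g e0.
  have cval : (val psi : {uniform @unit_interval R -> R}) @[psi --> phi] --> 
      (val phi : {uniform @unit_interval R -> R}).
    exact: initial_continuous.
  have dl2 : 0 < dl / 2 by rewrite divr_gt0.
  have : nbhs (val phi : {uniform @unit_interval R -> R})
      [set h | forall t, `|val phi t - h t| <= dl / 2].
    apply/uniform_nbhs; exists [set xy | ball xy.1 (dl / 2) xy.2].
    split; last by move=> h hb t; apply: ltW; exact: hb.
    by rewrite -entourage_ballE; exists (dl / 2).
  have incl (psi : @excursions R) :
      (forall t, `|val phi t - val psi t| <= dl / 2) ->
      `|permuton_pairing (val (G phi)) g - permuton_pairing (val (G psi)) g| < e.
    move=> close; apply: dlP.
    by have := dist_G phi psi _ close; rewrite mulr2n -splitr.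
  by move=> /cval; exact: (@filterS _ (nbhs phi) (nbhs_filter phi) _ _ incl).
Qed.
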